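(* Let $A\in\mathbb{S}^n$ and $\mu,\sigma\in\mathbb{R}^n$. Suppose: (a) $0\le\sigma_i\le\sqrt{\mu_i(1-\mu_i)}$ for all $i=1,\dots,n$ (in particular $\mu_i\in[0,1]$); (b) the matrix $-A$ is submodular. Let $$v^* = \max\left\{\mathbb{E}_{\mathbb{P}}[\tilde\xi^TA\tilde\xi] : \mathbb{P}\in\mathcal{P}([0,1]^n),\ \mathbb{E}_{\mathbb{P}}[\tilde\xi]=\mu,\ \mathbb{E}_{\mathbb{P}}[\mathrm{diag}(\tilde\xi\tilde\xi^T)]=\mathrm{diag}(\mu\mu^T+\sigma\sigma^T)\right\}.$$ Then the semidefinite program $$v^*_{\rm SDP}=\max\left\{A\bullet\Sigma : \Sigma\in\mathbb{S}^n,\ \mathrm{diag}(\Sigma)=\mathrm{diag}(\mu\mu^T+\sigma\sigma^T),\ \Sigma\le e\mu^T,\ \begin{pmatrix}1&\mu^T\\ \mu&\Sigma\end{pmatrix}\succeq 0\right\}$$ provides an upper bound $v^*\le v^*_{\rm SDP}$, with equality for $n\le 3$.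
   Context: $\mathbb{S}^n$ is the space of symmetric real $n\times n$ matrices; $\mathcal{P}([0,1]^n)$ is the set of probability distributions with support contained in $[0,1]^n$, and $\tilde\xi$ is the random vector with distribution $\mathbb{P}$; $e$ is the all-ones vector; $A\bullet B=\mathrm{trace}(A^TB)$; $\mathrm{diag}(A)$ is the vector of diagonal entries of $A$; $\Sigma\le e\mu^T$ is entrywise, i.e. $\Sigma_{ij}\le\mu_j$ for all $i,j$; $\succeq 0$ means positive semidefinite. A symmetric matrix is called submodular if all its off-diagonal entries are nonpositive. *)

(* Defs.v *)
From HB Require Import structures.
From mathcomp Require Import all_boot all_order all_algebra.
From mathcomp Require Import all_classical all_reals all_analysis.

Set Implicit Arguments.
Unset Strict Implicit.
Unset Printing Implicit Defensive.

Import Order.TTheory GRing.Theory Num.Theory.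
Local Open Scope classical_set_scope.
Local Open Scope ring_scope.

Definition is_max {d : Order.disp_t} {T : porderType d} (S : set T) (v : T) :=
  S v /\ ubound S v.

Section MatrixNotions.
Context {R : realType} {n : nat}.

Definition symmetric_mx (M : 'M[R]_n) := M^T = M.

Definition psd (M : 'M[R]_n) :=
  symmetric_mx M /\ forall x : 'cV[R]_n, 0 <= (x^T *m M *m x) 0 0.

Definition submodular (M : 'M[R]_n) :=
  symmetric_mx M /\ forall i j, i != j -> M i j <= 0.

(* not to be confused with [diag_mx], which builds a matrix from a vector *)
Definition diag (M : 'M[R]_n) : 'cV[R]_n := \col_i M i i.

Definition mxinner (M N : 'M[R]_n) : R := \tr (M^T *m N).

End MatrixNotions.

Section Problems.
Context {R : realType} {n : nat}.
Implicit Types (A : 'M[R]_n) (mu sigma : 'cV[R]_n).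

(* [n.-tuple R] carries the product of the Borel sigma-algebras, which is the
   Borel sigma-algebra of R^n. [colv] is the random vector xi, i.e. the identity
   on R^n, with values read as column vectors. *)
Definition colv (x : n.-tuple R) : 'cV[R]_n := \col_i tnth x i.

Definition unit_cube : set (n.-tuple R) :=
  [set x | forall i, 0 <= tnth x i <= 1].

(* The cube is closed, so having support in it means giving it mass one. *)
Definition moment_feasible mu sigma (P : probability (n.-tuple R) R) :=
  [/\ P unit_cube = 1,
      forall i, 'E_P[fun x => (colv x i 0)%R] = ((mu i 0)%R)%:E &
      forall i, 'E_P[fun x => (diag (colv x *m (colv x)^T) i 0)%R]
                = ((diag (mu *m mu^T + sigma *m sigma^T) i 0)%R)%:E]%E.

Definition moment_objective A (P : probability (n.-tuple R) R) : \bar R :=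
  'E_P[fun x => (((colv x)^T *m A *m colv x) 0 0)%R]%E.

Definition sdp_feasible mu sigma (Sigma : 'M[R]_n) :=
  [/\ symmetric_mx Sigma,
      diag Sigma = diag (mu *m mu^T + sigma *m sigma^T),
      forall i j, Sigma i j <= ((const_mx 1 : 'cV[R]_n) *m mu^T) i j &
      psd (block_mx (1%:M : 'M[R]_1) mu^T mu Sigma)].

End Problems.

(* Main.v *)
(* Every moment vector of a probability on the cube is the moment vector of a law
   with boundedly many atoms: the closest point among the latter cannot be improved
   by mixing in one more atom, because Caratheodory's reduction removes an atom
   again, and this variational inequality forces the distance to be zero. Both
   problems are then maxima of continuous functions over nonempty compact sets, and
   the second moments of a feasible law are feasible for the semidefinite program.

   For n <= 3, raise the off-diagonal entries of Sigma as far as possible, which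
   does not decrease the objective as those of A are nonnegative. A variable of
   variance zero is constant; otherwise, in terms of correlations, a maximal point is
   of one of three kinds: all correlations are 1; all bounds Sigma_ij <= mu_j are
   tight; or the correlation matrix is singular, one variable being a nonnegative
   combination of two others whose bound is tight. In the first case the variables
   are affine functions of a common two-valued variable. In the other two a tight
   pair (i, j) with mu_i <= mu_j forces xi_i = 0 or xi_j = 1, and three blocks with
   (xi_i, xi_j) = (0, 1 - d), (0, 1), (h, 1) carry the required law. *)

Require Import Defs.
From HB Require Import structures.
From mathcomp Require Import all_boot all_order all_algebra.
From mathcomp Require Import all_classical all_reals all_analysis.
From mathcomp Require Import measurable_realfun ring lra.
Import Order.TTheory GRing.Theory Num.Theory.
Import numFieldNormedType.Exports.
Local Open Scope classical_set_scope.
Local Open Scope ring_scope.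

Set Implicit Arguments.
Unset Strict Implicit.
Unset Printing Implicit Defensive.

(** * Compactness in product spaces *)

Section ContinuousFunctions.
Context {R : realType} {V : topologicalType}.
Implicit Types f g : V -> R.

Lemma continuous_addf f g : continuous f -> continuous g ->
  continuous (fun v => f v + g v).
Proof. by move=> cf cg v; apply: cvgD; [exact: cf|exact: cg]. Qed.

Lemma continuous_subf f g : continuous f -> continuous g ->
  continuous (fun v => f v - g v).
Proof. by move=> cf cg v; apply: cvgB; [exact: cf|exact: cg]. Qed.

Lemma continuous_mulf f g : continuous f -> continuous g ->
  continuous (fun v => f v * g v).
Proof. by move=> cf cg v; apply: cvgM; [exact: cf|exact: cg]. Qed.

Lemma continuous_sqrf f : continuous f -> continuous (fun v => f v ^+ 2).
Proof. by move=> cf; exact: continuous_mulf. Qed.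

Lemma continuous_constf (r : R) : continuous (fun _ : V => r).
Proof. by move=> v; exact: cvg_cst. Qed.

Lemma continuous_sumf (K : Type) (s : seq K) (f : K -> V -> R) :
  (forall k, continuous (f k)) -> continuous (fun v => \sum_(k <- s) f k v).
Proof.
move=> cf; elim: s => [|k s ih].
  by under eq_fun do rewrite big_nil; exact: continuous_constf.
by under eq_fun do rewrite big_cons; exact: continuous_addf.
Qed.

Lemma closed_le_fun f g : continuous f -> continuous g ->
  closed [set v | f v <= g v].
Proof.
move=> cf cg; have cgf := continuous_subf cg cf.
rewrite (_ : mkset _ = (fun v => g v - f v) @^-1` [set x | 0 <= x]).
  by apply: closed_comp => [v _|]; [exact: cgf|exact: closed_ge].
by apply/seteqP; split=> v /=; rewrite subr_ge0.
Qed.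

Lemma closed_eq_fun f g : continuous f -> continuous g ->
  closed [set v | f v = g v].
Proof.
move=> cf cg; rewrite (_ : mkset _ = [set v | f v <= g v] `&` [set v | g v <= f v]).
  by apply: closedI; exact: closed_le_fun.
apply/seteqP; split=> v /= [].
  by move=> ->.
by move=> fg gf; apply/le_anti; rewrite fg gf.
Qed.

Lemma closed_forall (K : Type) (P : K -> V -> Prop) :
  (forall k, closed [set v | P k v]) -> closed [set v | forall k, P k v].
Proof.
move=> cP; rewrite (_ : mkset _ = \bigcap_k [set v | P k v]).
  by apply: closed_bigI => k _; exact: cP.
by apply/seteqP; split=> v /= Pv k; [move=> _|]; exact: Pv.
Qed.

End ContinuousFunctions.

Lemma eval_continuous (R : realType) (J : choiceType) (j : J) :
  continuous (fun v : prod_topology (fun _ : J => R) => v j).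
Proof. exact: (@proj_continuous J (fun=> R) j). Qed.

(** Tychonoff makes the box compact, hence also its closed subset [K], and the extreme value theorem
    applies. Laws, matrices and correlation triples are all encoded as points of such products in
    order to use this. *)
Lemma box_argmax (R : realType) (J : choiceType)
    (K : set (prod_topology (fun _ : J => R))) f :
  K !=set0 -> closed K -> (forall v, K v -> forall j, -1 <= v j <= 1) ->
  continuous f -> exists2 v, K v & forall u, K u -> f u <= f v :> R.
Proof.
move=> K0 clK boxK cf.
have cK : compact K.
  have cB := @tychonoff J (fun=> R) (fun=> `[-1, 1]%classic)
    (fun=> @segment_compact R (-1) 1).
  apply: subclosed_compact clK cB _ => v Kv j.
  by rewrite /= in_itv /= boxK.
have [|v /set_mem Kv vmax] := compact_EVT_max K0 cK (f := f).
  by apply: continuous_subspaceT.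
by exists v => // u Ku; apply: vmax; rewrite inE.
Qed.

(** * Laws with finitely many atoms *)

Lemma linear_dependence (R : fieldType) (J : finType) N (p : 'I_N.+1 -> J -> R) :
  (#|J| <= N)%N ->
  exists2 c : 'I_N.+1 -> R, exists t, c t != 0 &
    forall j, \sum_t c t * p t j = 0.
Proof.
move=> JN; pose A := \matrix_(t < N.+1, k < #|J|) p t (enum_val k).
have /rowV0Pn[v /sub_kermxP vA v0] : kermx A != 0.
  by rewrite kermx_eq0 /row_free neq_ltn (leq_ltn_trans (rank_leq_col A)).
exists (v 0) => [|j].
  apply/existsP; apply: contraNT v0 => /existsPn v0; apply/eqP/rowP => t.
  by rewrite mxE; apply/eqP/negPn/v0.
have /rowP/(_ (enum_rank j)) := vA.
rewrite !mxE => vAj; rewrite -[RHS]vAj; apply: eq_bigr => t _.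
by rewrite mxE enum_rankK.
Qed.

(** The weights are moved along a linear dependence of the points until a first one vanishes; its
    atom [s] is dropped. *)
Lemma caratheodory_step (R : realType) (J : finType) N
    (w : 'I_N.+1 -> R) (p : 'I_N.+1 -> J -> R) (j0 : J) :
  (#|J| <= N)%N -> (forall t, 0 <= w t) -> (forall t, p t j0 = 1) ->
  exists (s : 'I_N.+1) (w' : 'I_N -> R), (forall t, 0 <= w' t) /\
    forall j, \sum_t w' t * p (lift s t) j = \sum_t w t * p t j.
Proof.
move=> JN w0 pj0; have [c [t1 ct1] cp] := linear_dependence p JN.
(* Coordinate [j0], equal to 1 at every point, makes the coefficients sum to zero, so they cannot
   all be nonpositive. *)
have [t0 ct0] : exists t, 0 < c t.
  apply/existsP; apply: contraNT ct1 => /existsPn cle.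
  have sumc : \sum_t (- c t) = 0.
    have := cp j0; under eq_bigr do rewrite pj0 mulr1.
    by rewrite sumrN => ->; rewrite oppr0.
  have Nc0 t : true -> 0 <= - c t by rewrite oppr_ge0 leNgt cle.
  by have /(_ t1 isT)/eqP := psumr_eq0P Nc0 sumc; rewrite oppr_eq0.
(* Ratio test: the smallest w/c over positive c is the largest step that keeps all weights
   nonnegative. *)
case: (@arg_minP _ _ _ t0 (fun t => 0 < c t) (fun t => w t / c t) ct0) => s cs smin.
exists s, (fun t => w (lift s t) - w s / c s * c (lift s t)); split=> [t|j].
  have [ct|ct] := ltP 0 (c (lift s t)).
    by rewrite subr_ge0 -ler_pdivlMr// smin.
  rewrite subr_ge0 (le_trans _ (w0 _))// mulr_ge0_le0// divr_ge0// ltW//.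
transitivity (\sum_t (w t - w s / c s * c t) * p t j).
  rewrite [RHS](bigD1_ord s)//= divfK ?gt_eqF// subrr mul0r add0r.
  by [].
under eq_bigr do rewrite mulrBl -(mulrA (w s / c s)).
by rewrite sumrB -mulr_sumr cp mulr0 subr0.
Qed.

Section Moments.
Context {R : realType} {n : nat}.
Implicit Types (x y : 'I_n -> R).

(** [None] stands for the constant monomial: the total mass is then a moment like the others, and
    Caratheodory's reduction preserves it. *)
Definition monomial_index := option ('I_n + 'I_n * 'I_n)%type.

Definition monomial x (j : monomial_index) : R :=
  match j with
  | None => 1
  | Some (inl i) => x i
  | Some (inr ik) => x ik.1 * x ik.2
  end.

Definition cube_law (T : finType) (w : T -> R) (x : T -> 'I_n -> R) :=
  [/\ forall t, 0 <= w t, \sum_t w t = 1 & forall t i, 0 <= x t i <= 1].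

Definition moment (T : finType) (w : T -> R) (x : T -> 'I_n -> R) j :=
  \sum_t w t * monomial (x t) j.

Lemma moment_None (T : finType) (w : T -> R) (x : T -> 'I_n -> R) :
  moment w x None = \sum_t w t.
Proof. by apply: eq_bigr => t _; rewrite mulr1. Qed.

(** The number of monomials, the constant one included: any further atom can be removed by
    [caratheodory_step]. *)
Definition natoms := #|{: 'I_n + 'I_n * 'I_n}|.+1.

(* A law with [natoms] atoms is encoded as a point of a product space: [(t, None)]
   indexes the weight of the [t]-th atom and [(t, Some i)] its [i]-th coordinate. *)
Definition law_space :=
  prod_topology (fun _ : 'I_natoms * option 'I_n => R).
Definition law_weight (v : law_space) (t : 'I_natoms) : R := v (t, None).
Definition law_atom (v : law_space) (t : 'I_natoms) (i : 'I_n) : R :=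
  v (t, Some i).
Definition laws : set law_space :=
  [set v | cube_law (law_weight v) (law_atom v)].

Lemma law_weight_continuous t : continuous (law_weight^~ t).
Proof. exact: eval_continuous. Qed.

Lemma law_atom_continuous t i : continuous (fun v => law_atom v t i).
Proof. exact: eval_continuous. Qed.

Lemma moment_continuous j :
  continuous (fun v => moment (law_weight v) (law_atom v) j).
Proof.
apply: continuous_sumf => t; apply: continuous_mulf => //.
  exact: law_weight_continuous.
case: j => [[i|[i k]]|] /=; last exact: continuous_constf.
- exact: law_atom_continuous.
- by apply: continuous_mulf; exact: law_atom_continuous.
Qed.

Lemma laws_closed : closed laws.
Proof.
rewrite (_ : laws = [set v | forall t, 0 <= law_weight v t] `&`
    [set v | \sum_t law_weight v t = 1] `&`
    [set v | forall t i, 0 <= law_atom v t i] `&`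
    [set v | forall t i, law_atom v t i <= 1]); last first.
  apply/seteqP; split=> v /=.
    by move=> [w0 w1 x01]; do ![split=> //] => t i; have /andP[] := x01 t i.
  by move=> [[[w0 w1] x0] x1]; split=> // t i; rewrite x0 x1.
repeat apply: closedI.
- apply: closed_forall => t; apply: closed_le_fun; first exact: continuous_constf.
  exact: law_weight_continuous.
- apply: closed_eq_fun; last exact: continuous_constf.
  by apply: continuous_sumf => t; exact: law_weight_continuous.
- do 2!apply: closed_forall => ?; apply: closed_le_fun; first exact: continuous_constf.
  exact: law_atom_continuous.
- do 2!apply: closed_forall => ?; apply: closed_le_fun; last exact: continuous_constf.
  exact: law_atom_continuous.
Qed.

Lemma laws_box v : laws v -> forall j, -1 <= v j <= 1.
Proof.
have N10 : -1 <= 0 :> R by rewrite lerN10.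
move=> [w0 w1 x01] [t [i|]].
  by have /andP[x0 x1] := x01 t i; rewrite x1 (le_trans N10 x0).
rewrite (le_trans N10 (w0 t)) /= -w1 (bigD1 t)//= lerDl.
by apply: sumr_ge0 => s _; exact: w0.
Qed.

(** Adding the atom [y] with weight [s] gives one atom too many; Caratheodory's reduction removes
    one and keeps every moment. *)
Lemma laws_mix v y (s : R) : laws v -> (forall i, 0 <= y i <= 1) ->
  0 <= s <= 1 ->
  exists2 u, laws u & forall j, moment (law_weight u) (law_atom u) j =
    s * monomial y j + (1 - s) * moment (law_weight v) (law_atom v) j.
Proof.
move=> [w0 w1 x01] y01 /andP[s0 s1].
pose W (t : 'I_natoms.+1) :=
  if unlift ord0 t is Some t' then (1 - s) * law_weight v t' else s.
pose X (t : 'I_natoms.+1) :=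
  if unlift ord0 t is Some t' then law_atom v t' else y.
have momWX j : \sum_t W t * monomial (X t) j =
    s * monomial y j + (1 - s) * moment (law_weight v) (law_atom v) j.
  rewrite big_ord_recl /W /X unlift_none; congr (_ + _).
  by rewrite mulr_sumr; apply: eq_bigr => t _; rewrite liftK mulrA.
have [|t||s' [w' [w'0 w'E]]] :=
    @caratheodory_step R monomial_index natoms W (monomial \o X) None _ _ _.
- by rewrite card_option.
- rewrite /W; case: unliftP => // t' _.
  by rewrite mulr_ge0// subr_ge0.
- by [].
pose u : law_space := fun ti =>
  if ti.2 is Some i then X (lift s' ti.1) i else w' ti.1.
have uE j : moment (law_weight u) (law_atom u) j =
    s * monomial y j + (1 - s) * moment (law_weight v) (law_atom v) j.
  by rewrite -momWX -w'E.
exists u => //; split=> //.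
  by rewrite -(moment_None _ (law_atom u)) uE moment_None w1 /= !mulr1 subrKC.
by move=> t i; rewrite /law_atom /u /X /=; case: unliftP.
Qed.

(** First-order condition at s = 0. If a > 0, the case s = 1 gives b >= 2a, so s = a/b is
    admissible, and it contradicts the hypothesis. *)
Lemma le0_quadratic (a b : R) :
  (forall s, 0 <= s <= 1 -> s * a *+ 2 <= s ^+ 2 * b) -> a <= 0.
Proof.
move=> ab; rewrite leNgt; apply/negP => a0.
have b2a : 2 * a <= b.
  by have := ab 1; rewrite ler01 lexx expr1n !mul1r mulr_natl => /(_ isT).
have b0 : 0 < b by rewrite (lt_le_trans _ b2a)// mulr_gt0.
have r01 : 0 <= a / b <= 1.
  by rewrite divr_ge0 ?(ltW a0) ?(ltW b0)//= ler_pdivrMr// mul1r; lra.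
have ra0 : 0 < a / b * a by rewrite mulr_gt0// divr_gt0.
have := ab _ r01; rewrite expr2 -(mulrA (a / b)) divfK ?gt_eqF// -mulr_natr.
by move: ra0; set z := a / b * a; lra.
Qed.

(* The projection of [m] on the moments of laws is [m] itself: the displacement
   [d] towards it satisfies [sum_j d_j (monomial y j - k_j) <= 0] on the cube,
   whence [|d|^2 <= 0]. *)
Lemma moments_of_laws (m : monomial_index -> R) : m None = 1 ->
  (forall (d : monomial_index -> R) c,
    (forall y, (forall i, 0 <= y i <= 1) -> \sum_j d j * monomial y j <= c) ->
    \sum_j d j * m j <= c) ->
  exists2 v, laws v & forall j, moment (law_weight v) (law_atom v) j = m j.
Proof.
move=> m1 mle.
pose k v j := moment (law_weight v) (law_atom v) j.
pose F v := - \sum_j (m j - k v j) ^+ 2.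
have laws0 : laws !=set0.
  exists (fun ti : 'I_natoms * option 'I_n =>
    if ti is (t, None) then (t == ord0)%:R else 0); split=> //.
  - by rewrite /law_weight (bigD1 ord0)//= big1 ?addr0// => t /negbTE ->.
  - by move=> t i; rewrite lexx ler01.
have cF : continuous F.
  rewrite (_ : F = fun v => 0 - \sum_j (m j - k v j) * (m j - k v j)).
    apply: continuous_subf; first exact: continuous_constf.
    by apply: continuous_sumf => j; apply: continuous_mulf;
      apply: continuous_subf; (exact: continuous_constf || exact: moment_continuous).
  by apply/funext => v; rewrite sub0r /F; under [in LHS]eq_bigr do rewrite expr2.
have [v Kv vmax] := box_argmax laws0 laws_closed laws_box cF.
exists v => //; pose d j := m j - k v j.
have dle y : (forall i, 0 <= y i <= 1) ->
    \sum_j d j * monomial y j <= \sum_j d j * k v j.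
  move=> y01; rewrite -subr_le0 -sumrB.
  (* Moving by [s] from [v] towards the point mass at [y] cannot decrease the squared distance to
     [m]; its expansion in [s] is the required inequality. *)
  apply: (@le0_quadratic _ (\sum_j (monomial y j - k v j) ^+ 2)) => s s01.
  have [u Ku uE] := laws_mix Kv y01 s01.
  have := vmax u Ku; rewrite /F lerN2 -subr_ge0 -sumrB.
  move=> h; rewrite -subr_ge0; apply: le_trans h _.
  rewrite le_eqVlt; apply/orP; left; apply/eqP.
  rewrite !mulr_sumr -sumrMnl -sumrB; apply: eq_bigr => j _.
  by rewrite /d /k uE -/(k v j); ring.
have : \sum_j d j ^+ 2 <= 0.
  have := mle d _ dle; rewrite -subr_le0 -sumrB; apply: le_trans.
  by apply: ler_sum => j _; rewrite -mulrBr expr2.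
move=> d0 j; apply/eqP; rewrite eq_sym -subr_eq0 -sqrf_eq0; apply/eqP.
have dge0 j' : true -> 0 <= d j' ^+ 2 by rewrite sqr_ge0.
have /le_anti d00 : \sum_j d j ^+ 2 <= 0 <= \sum_j d j ^+ 2.
  by rewrite d0 sumr_ge0.
by have /(_ j isT) := psumr_eq0P dge0 d00.
Qed.

End Moments.

(** * Probabilities on the cube *)

Section CubeProbability.
Context {R : realType} {n : nat}.
Local Notation cube := (@unit_cube R n).

Lemma measurable_unit_cube : measurable cube.
Proof.
rewrite (_ : cube = \big[setI/setT]_(i < n) ((fun x => tnth x i) @^-1` `[0, 1])).
  apply: bigsetI_measurable => i _; rewrite -[X in measurable X]setTI.
  exact: measurable_tnth.
rewrite -bigcap_seq; apply/seteqP; split=> x /=.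
  by move=> x01 i _; rewrite /= in_itv /= x01.
by move=> x01 i; have := x01 i; rewrite /= in_itv /= mem_index_enum; apply.
Qed.

Lemma measurable_monomial j :
  measurable_fun setT (fun x : n.-tuple R => monomial (tnth x) j).
Proof.
case: j => [[i|[i k]]|] /=; last exact: measurable_cst.
- exact: measurable_tnth.
- by apply: measurable_funM; exact: measurable_tnth.
Qed.

Lemma monomial_bound (y : 'I_n -> R) j :
  (forall i, 0 <= y i <= 1) -> 0 <= monomial y j <= 1.
Proof.
move=> y01; case: j => [[i|[i k]]|] //=; last by rewrite ler01 lexx.
have /andP[i0 i1] := y01 i; have /andP[k0 k1] := y01 k.
by rewrite mulr_ge0//= mulr_ile1.
Qed.

Variables (P : probability (n.-tuple R) R) (Pcube : P cube = 1%E).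

(** The complement of the cube is negligible, so integrals can be taken over the cube, where
    monomials are bounded. *)
Lemma expectation_cube (f : n.-tuple R -> R) : measurable_fun setT f ->
  P.-integrable cube (EFin \o f) ->
  ('E_P[f] = (\int[P]_(x in cube) f x)%:E)%E.
Proof.
move=> mf intf; have mcube := measurable_unit_cube.
have mcubeC := measurableC mcube.
have PC0 : P (~` cube) = 0%E by rewrite probability_setC// Pcube subee.
have intT : P.-integrable setT (EFin \o f).
  rewrite (negligible_integrable mcubeC)// ?setTD ?setCK//.
  exact/measurable_EFinP.
rewrite unlock (negligible_integral mcubeC)//= setTD setCK.
by rewrite /Rintegral fineK//; exact: integrable_fin_num.
Qed.

Lemma integrable_monomial j :
  P.-integrable cube (EFin \o fun x => monomial (tnth x) j).
Proof.
apply: measurable_bounded_integrable; first exact: measurable_unit_cube.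
- by apply: le_lt_trans (ltry 1); rewrite -Pcube.
- by apply: measurable_funS (measurable_monomial j).
- exists 1; split=> // M M1 x /= x01.
  have /andP[m0 m1] := monomial_bound j x01.
  by rewrite ger0_norm// (le_trans m1)// ltW.
Qed.

Lemma Rintegral_cube_cst (c : R) : \int[P]_(x in cube) c = c.
Proof.
rewrite Rintegral_cst; last exact: measurable_unit_cube.
have -> : fine (P cube) = 1 by rewrite Pcube.
by rewrite mulr1.
Qed.

Definition cube_moment j := \int[P]_(x in cube) monomial (tnth x) j.

Lemma cube_moment_None : cube_moment None = 1.
Proof. exact: Rintegral_cube_cst. Qed.

(** Measurability and integrability are carried along because the induction needs them for the tail.
    The free family [j] covers both the full moment vector and the quadratic objective. *)
Lemma cube_moment_sum (K : Type) (s : seq K) (c : K -> R) (j : K -> monomial_index) :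
  let f := fun x : n.-tuple R => \sum_(k <- s) c k * monomial (tnth x) (j k) in
  [/\ measurable_fun setT f, P.-integrable cube (EFin \o f) &
      \int[P]_(x in cube) f x = \sum_(k <- s) c k * cube_moment (j k)].
Proof.
elim: s => [|k s [mf intf fE]] /=.
  rewrite big_nil (_ : (fun x => _) = cst 0); last first.
    by apply/funext => x; rewrite big_nil.
  split; [exact: measurable_cst| |exact: Rintegral_cube_cst].
  exact: finite_measure_integrable_cst measurable_unit_cube.
have mcube := measurable_unit_cube.
have mk : measurable_fun setT (fun x : n.-tuple R => c k * monomial (tnth x) (j k)).
  by apply: measurable_funM (measurable_monomial _); exact: measurable_cst.
have ik : P.-integrable cube (EFin \o fun x => c k * monomial (tnth x) (j k)).
  have := integrableZl mcube (c k) (integrable_monomial (j k)).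
  by under eq_fun do rewrite /= -EFinM.
rewrite big_cons (_ : (fun x => _) = (fun x => c k * monomial (tnth x) (j k) +
    \sum_(k <- s) c k * monomial (tnth x) (j k))); last first.
  by apply/funext => x; rewrite big_cons.
split.
- exact: measurable_funD.
- have := integrableD mcube ik intf.
  by under eq_fun do rewrite /= -EFinD.
- by rewrite RintegralD// fE RintegralZl//; exact: integrable_monomial.
Qed.

Lemma expectation_monomial j :
  ('E_P[fun x => monomial (tnth x) j] = (cube_moment j)%:E)%E.
Proof. exact: expectation_cube (measurable_monomial j) (integrable_monomial j). Qed.

(** The pointwise inequality is integrated over a cube of mass one. This is the hypothesis that
    [moments_of_laws] puts on a moment vector. *)
Lemma cube_moment_le (d : monomial_index -> R) c :
  (forall y, (forall i, 0 <= y i <= 1) -> \sum_j d j * monomial y j <= c) ->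
  \sum_j d j * cube_moment j <= c.
Proof.
move=> dc; have [_ intf <-] := cube_moment_sum (index_enum _) d id.
have mcube := measurable_unit_cube.
rewrite -[leRHS]Rintegral_cube_cst.
apply: le_Rintegral => //; first exact/finite_measure_integrable_cst.
by move=> x x01; exact: dc.
Qed.

Lemma cube_moment_laws : exists2 v, laws v &
  forall j, moment (law_weight v) (law_atom v) j = cube_moment j.
Proof.
by apply: moments_of_laws; [exact: cube_moment_None|exact: cube_moment_le].
Qed.

End CubeProbability.

Lemma probability_of_atoms (R : realType) (n : nat) (T : finType) (w : T -> R)
    (x : T -> 'I_n -> R) : cube_law w x ->
  exists P : probability (n.-tuple R) R, P (@unit_cube R n) = 1%E /\
    forall j, cube_moment P j = moment w x j.
Proof.
(* [msum] expects a sequence of measures, so the atoms are listed by rank. Past the last rank the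
   defaults are weight 0 and the origin, which still lies in the cube. *)
move=> [w0 w1 x01]; pose rank (k : nat) : option 'I_#|T| := insub k.
pose W k : R := oapp (fun i => w (enum_val i)) 0 (rank k).
pose X k : n.-tuple R := oapp (fun i => mktuple (x (enum_val i))) [tuple 0 | i < n] (rank k).
have W0 k : 0 <= W k by rewrite /W; case: (rank k) => /=.
have XE k : unit_cube (X k).
  by move=> i; rewrite /X; case: (rank k) => [s|] /=; rewrite tnth_mktuple ?lexx ?ler01.
pose Q k := mscale (NngNum (W0 k)) (dirac (X k)).
have sumE (f : T -> R) : \sum_t f t = \sum_(k < #|T|) oapp (f \o enum_val) 0 (rank k).
  rewrite (reindex _ (onW_bij _ (enum_val_bij T)))/=.
  by apply: eq_bigr => k _; rewrite /rank valK.
(* Allowing any [D] that contains the cube settles at once the total mass, the mass of the cube and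
   the moments. *)
have integralE (D : set (n.-tuple R)) (f : n.-tuple R -> R) : measurable D ->
    unit_cube `<=` D -> measurable_fun D f -> (forall y, D y -> 0 <= f y) ->
    (\int[msum Q #|T|]_(y in D) (f y)%:E)%E =
    (\sum_t w t * f (mktuple (x t)))%:E.
  move=> mD cubeD mf f0.
  have mfE : measurable_fun D (EFin \o f) by exact/measurable_EFinP.
  rewrite ge0_integral_measure_sum// sumE -sumEFin; apply: eq_bigr => k _.
  rewrite ge0_integral_mscale// integral_dirac// diracE mem_set; last exact/cubeD/XE.
  by rewrite mul1e /= -EFinM /W /X /rank valK.
have mass1 D : measurable D -> unit_cube `<=` D -> msum Q #|T| D = 1%E.
  move=> mD cubeD; rewrite -[LHS]mul1e -(integral_cst _ mD).
  etransitivity; first exact: (integralE D (cst 1) mD cubeD (@measurable_cst _ _ _ _ _ _)).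
  by under eq_bigr do rewrite mulr1; rewrite w1.
have Q1 : msum Q #|T| setT = 1%E by exact: mass1.
pose P : probability (n.-tuple R) R :=
  HB.pack (msum Q #|T|) (Measure_isProbability.Build _ _ _ (msum Q #|T|) Q1).
have mcube := @measurable_unit_cube R n.
exists P; split; first exact: mass1.
move=> j; rewrite /cube_moment /Rintegral integralE//.
- apply: eq_bigr => t _; congr (_ * monomial _ _).
  by apply/funext => i; rewrite tnth_mktuple.
- by apply: measurable_funS (measurable_monomial j).
- by move=> y y01; have /andP[] := monomial_bound j y01.
Qed.

(** * Three variables *)

Section ThreeVariables.
Context {R : realType}.
Implicit Types (m v c s p q h d : R).

Lemma quadratic_discr (r a b : R) : 0 <= r ->
  (forall g, 0 <= r * g ^+ 2 - 2 * g * a + b) -> a ^+ 2 <= r * b.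
Proof.
rewrite le_eqVlt => /predU1P[<- rab|r0 rab].
  rewrite mul0r; have [->|a0] := eqVneq a 0; first by rewrite expr0n.
  (* With r = 0 the form is affine in g, and this g gives it the value -1. *)
  have := rab ((b + 1) / (2 * a)); rewrite mul0r add0r.
  rewrite (_ : 2 * _ * a = b + 1); first by lra.
  by field.
(* The minimizer of the form. *)
have := rab (a / r).
rewrite (_ : _ + b = (r * b - a ^+ 2) / r); last by field; rewrite gt_eqF.
by rewrite pmulr_lge0 ?invr_gt0// subr_ge0.
Qed.

(** A measure of mass r on [0, 1] with first moment a and second moment b: mass v = a^2/b at y = b/a
    and the rest at 0. Cauchy-Schwarz gives v <= r, and b <= a gives y <= 1. *)
Lemma two_point (r a b : R) : 0 <= r -> a ^+ 2 <= r * b -> 0 <= b <= a ->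
  exists v y, [/\ 0 <= v <= r, 0 <= y <= 1, v * y = a & v * y ^+ 2 = b].
Proof.
move=> r0 abr /andP[b0 ba].
have [b00|bN0] := eqVneq b 0.
  have a0 : a = 0.
    by apply/eqP; rewrite -sqrf_eq0 eq_le sqr_ge0 andbT (le_trans abr)// b00 mulr0.
  by exists 0, 0; rewrite !lexx ler01 !mul0r a0 b00 r0.
have bp : 0 < b by rewrite lt_neqAle eq_sym bN0.
have ap : 0 < a by exact: lt_le_trans ba.
exists (a ^+ 2 / b), (b / a); split.
- by rewrite divr_ge0 ?sqr_ge0//= ler_pdivrMr.
- by rewrite divr_ge0 ?(ltW ap)//= ler_pdivrMr// mul1r.
- by field; rewrite !gt_eqF.
- by field; rewrite !gt_eqF.
Qed.

Definition cov_psd v1 v2 v3 c12 c13 c23 := forall a b c : R,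
  0 <= a ^+ 2 * v1 + b ^+ 2 * v2 + c ^+ 2 * v3 +
       2 * (a * b * c12 + a * c * c13 + b * c * c23).

(** The parameters are means, variances and covariances, while the conditions concern uncentred
    moments. *)
Definition law3 m1 m2 m3 v1 v2 v3 c12 c13 c23 :=
  exists (T : finType) (w x1 x2 x3 : T -> R),
  [/\ forall t, 0 <= w t, \sum_t w t = 1,
      forall t, [/\ 0 <= x1 t <= 1, 0 <= x2 t <= 1 & 0 <= x3 t <= 1],
      [/\ \sum_t w t * x1 t = m1, \sum_t w t * x2 t = m2 &
          \sum_t w t * x3 t = m3] &
      [/\ \sum_t w t * (x1 t * x1 t) = m1 ^+ 2 + v1,
          \sum_t w t * (x2 t * x2 t) = m2 ^+ 2 + v2 &
          \sum_t w t * (x3 t * x3 t) = m3 ^+ 2 + v3] /\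
      [/\ \sum_t w t * (x1 t * x2 t) = m1 * m2 + c12,
          \sum_t w t * (x1 t * x3 t) = m1 * m3 + c13 &
          \sum_t w t * (x2 t * x3 t) = m2 * m3 + c23]].

Lemma law3_swap12 m1 m2 m3 v1 v2 v3 c12 c13 c23 :
  law3 m2 m1 m3 v2 v1 v3 c12 c23 c13 -> law3 m1 m2 m3 v1 v2 v3 c12 c13 c23.
Proof.
move=> [T [w [x1 [x2 [x3 [w0 w1 x01 [e1 e2 e3] [[e4 e5 e6] [e7 e8 e9]]]]]]]].
exists T, w, x2, x1, x3; split=> //.
  by move=> t; have [] := x01 t.
split; split=> //; rewrite mulrC -e7; apply: eq_bigr => t _.
by rewrite (mulrC (x2 t)).
Qed.

Lemma law3_swap23 m1 m2 m3 v1 v2 v3 c12 c13 c23 :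
  law3 m1 m3 m2 v1 v3 v2 c13 c12 c23 -> law3 m1 m2 m3 v1 v2 v3 c12 c13 c23.
Proof.
move=> [T [w [x1 [x2 [x3 [w0 w1 x01 [e1 e2 e3] [[e4 e5 e6] [e7 e8 e9]]]]]]]].
exists T, w, x1, x3, x2; split=> //.
  by move=> t; have [] := x01 t.
split; split=> //; rewrite mulrC -e9; apply: eq_bigr => t _.
by rewrite (mulrC (x3 t)).
Qed.

Lemma cov_psd_swap12 v1 v2 v3 c12 c13 c23 :
  cov_psd v1 v2 v3 c12 c13 c23 -> cov_psd v2 v1 v3 c12 c23 c13.
Proof. by move=> psd a b c; apply: le_trans (psd b a c) _; lra. Qed.

Lemma cov_psd_swap23 v1 v2 v3 c12 c13 c23 :
  cov_psd v1 v2 v3 c12 c13 c23 -> cov_psd v1 v3 v2 c13 c12 c23.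
Proof. by move=> psd a b c; apply: le_trans (psd a c b) _; lra. Qed.

(* The law sits on the points [(0, yl, 1 - d)], [(0, *, 1)] and [(h, yh, 1)] with
   masses [q], [r = 1 - p - q] and [p]; the residual variance of the second
   coordinate is carried by the middle point. *)
Lemma three_block p h q d m2 v2 yl yh :
  let m1 := p * h in let m3 : R := 1 - q * d in let r : R := 1 - p - q in
  let a := m2 - q * yl - p * yh in
  let b := m2 ^+ 2 + v2 - q * yl ^+ 2 - p * yh ^+ 2 in
  let v1 := p * h ^+ 2 - m1 ^+ 2 in
  let v3 : R := 1 - 2 * q * d + q * d ^+ 2 - m3 ^+ 2 in
  let c12 := m1 * yh - m1 * m2 in
  let c13 := m1 - m1 * m3 in
  let c23 := m2 - q * d * yl - m2 * m3 in
  0 <= p -> 0 <= q -> 0 < h <= 1 -> 0 < d <= 1 ->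
  0 <= yl <= 1 -> 0 <= yh <= 1 -> (0 <= r -> b <= a) ->
  cov_psd v1 v2 v3 c12 c13 c23 ->
  law3 m1 m2 m3 v1 v2 v3 c12 c13 c23.
Proof.
move=> m1 m3 r a b v1 v3 c12 c13 c23 p0 q0 /andP[h0 h1] /andP[d0 d1] yl01 yh01 ba psd.
have hN0 : h != 0 by rewrite gt_eqF.
have dN0 : d != 0 by rewrite gt_eqF.
have r0 : 0 <= r.
  (* On the three blocks, - x1 / h + x3 / d is up to a constant the indicator of the middle one,
     whose variance is r - r^2. *)
  have := psd (- h^-1) 0 d^-1.
  rewrite (_ : _ + _ = r - r ^+ 2); first by have := sqr_ge0 r; lra.
  by rewrite /v1 /v3 /c13 /r /m1 /m3; field; rewrite hN0 dN0.
have rab g : 0 <= r * g ^+ 2 - 2 * g * a + b.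
  (* Here [a] and [b] are the first and second moments of x2 left to the middle block. Up to a
     constant, this combination subtracts from x2 the values yl, g, yh on the three blocks; the
     residual lives on the middle one, with mean a - r g and second moment r g^2 - 2 g a + b. *)
  have := psd (- (yh - g) / h) 1 (- (g - yl) / d).
  rewrite [X in 0 <= X -> _](_ : _ = r * g ^+ 2 - 2 * g * a + b - (a - r * g) ^+ 2).
    by rewrite subr_ge0; apply: le_trans; exact: sqr_ge0.
  by rewrite /v1 /v3 /c12 /c13 /c23 /a /b /r /m1 /m3; field; rewrite hN0 dN0.
have b0 : 0 <= b by have := rab 0; rewrite !(mulr0, mul0r) expr0n /= mulr0 subr0 add0r.
have [|v [y [/andP[v0 vr] y01 vy vy2]]] := two_point r0 (quadratic_discr r0 rab).
  by rewrite b0 ba.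
(* The middle block is split: mass v at x2 = y and mass r - v at x2 = 0. *)
exists 'I_4, (fun t : 'I_4 => [:: q; r - v; v; p]`_t), (fun t : 'I_4 => [:: 0; 0; 0; h]`_t),
  (fun t : 'I_4 => [:: yl; 0; y; yh]`_t), (fun t : 'I_4 => [:: 1 - d; 1; 1; 1]`_t).
have sumE (f : 'I_4 -> R) : \sum_t f t = f 0 + f 1 + f 2%:R + f 3%:R.
  by rewrite !big_ord_recl big_ord0 addr0 !addrA; congr (f _ + f _ + f _ + f _); exact/val_inj.
have aE : a = m2 - q * yl - p * yh by [].
have bE : b = m2 ^+ 2 + v2 - q * yl ^+ 2 - p * yh ^+ 2 by [].
have all4 (Q : 'I_4 -> Prop) : Q 0 -> Q 1 -> Q 2%:R -> Q 3%:R -> forall t, Q t.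
  move=> q0' q1 q2 q3 [[|[|[|[|//]]]] lt4].
  - by rewrite (_ : Ordinal _ = 0)//; exact/val_inj.
  - by rewrite (_ : Ordinal _ = 1)//; exact/val_inj.
  - by rewrite (_ : Ordinal _ = 2%:R)//; exact/val_inj.
  - by rewrite (_ : Ordinal _ = 3%:R)//; exact/val_inj.
split.
- by apply: all4 => //=; rewrite subr_ge0.
- by rewrite sumE /= /r; lra.
- have d01 : 0 <= 1 - d <= 1 by lra.
  by apply: all4; split=> //=; rewrite ?lexx ?ler01// (ltW h0) h1.
- rewrite !sumE /=; split.
  + by rewrite /m1; ring.
  + by rewrite vy aE; ring.
  + by rewrite /m3 /r; ring.
- rewrite !sumE /=; split; split.
  + by rewrite /v1; ring.
  + rewrite -[v * (y * y)]/(v * y ^+ 2) vy2 bE; ring.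
  + by rewrite /v3 /r; ring.
  + by rewrite /c12 /m1; ring.
  + by rewrite /c13 /m1; ring.
  + by rewrite (mulr1 y) vy aE /c23; ring.
Qed.

(** Tightness of c13 says E[x1 (1 - x3)] = 0, so x1 = 0 or x3 = 1. The mean and variance of x1 fix a
    single nonzero value h and its mass p; those of 1 - x3 fix d and q; then c23 and c12 fix the
    values yl and yh of x2 on the outer blocks. *)
Lemma tight_pair m1 m2 m3 v1 v2 v3 c12 c13 c23 :
  let p := m1 ^+ 2 / (m1 ^+ 2 + v1) in
  let q := (1 - m3) ^+ 2 / ((1 - m3) ^+ 2 + v3) in
  let yl := m2 - c23 / (1 - m3) in let yh := m2 + c12 / m1 in
  0 < m1 -> m3 < 1 -> 0 <= v1 <= m1 * (1 - m1) -> 0 <= v3 <= m3 * (1 - m3) ->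
  c12 <= m1 * (1 - m2) -> c23 <= m2 * (1 - m3) -> c13 = m1 * (1 - m3) ->
  yl <= 1 -> 0 <= yh ->
  (0 <= 1 - p - q ->
    m2 ^+ 2 + v2 - q * yl ^+ 2 - p * yh ^+ 2 <= m2 - q * yl - p * yh) ->
  cov_psd v1 v2 v3 c12 c13 c23 ->
  law3 m1 m2 m3 v1 v2 v3 c12 c13 c23.
Proof.
move=> p q yl yh m10; rewrite -subr_gt0 => m31 /andP[v10 v1m] /andP[v30 v3m].
move=> c12m c23m c13E yl1 yh0 ba.
pose h := (m1 ^+ 2 + v1) / m1; pose d := ((1 - m3) ^+ 2 + v3) / (1 - m3).
have s1 : 0 < m1 ^+ 2 + v1 by rewrite ltr_pwDl// exprn_gt0.
have s3 : 0 < (1 - m3) ^+ 2 + v3 by rewrite ltr_pwDl// exprn_gt0.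
have m1N0 : m1 != 0 by rewrite gt_eqF.
have m3N0 : 1 - m3 != 0 by rewrite gt_eqF.
have s1N0 : m1 ^+ 2 + v1 != 0 by rewrite gt_eqF.
have s3N0 : (1 - m3) ^+ 2 + v3 != 0 by rewrite gt_eqF.
have phE : p * h = m1 by rewrite /p /h; field; rewrite m1N0 s1N0.
have qdE : q * d = 1 - m3 by rewrite /q /d; field; rewrite m3N0 s3N0.
have ph2E : p * h ^+ 2 = m1 ^+ 2 + v1 by rewrite /p /h; field; rewrite m1N0 s1N0.
have qd2E : q * d ^+ 2 = (1 - m3) ^+ 2 + v3 by rewrite /q /d; field; rewrite m3N0 s3N0.
have m3E : 1 - q * d = m3 by rewrite qdE; ring.
have v1E : p * h ^+ 2 - (p * h) ^+ 2 = v1 by rewrite ph2E phE; ring.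
have v3E : 1 - 2 * q * d + q * d ^+ 2 - (1 - q * d) ^+ 2 = v3.
  by rewrite qd2E m3E -(mulrA 2) qdE; ring.
have c12E : p * h * yh - p * h * m2 = c12 by rewrite phE /yh; field.
have c13E' : p * h - p * h * (1 - q * d) = c13 by rewrite m3E phE c13E; ring.
have c23E : m2 - q * d * yl - m2 * (1 - q * d) = c23.
  by rewrite m3E qdE /yl; field.
have hd : 0 < h <= 1 by rewrite divr_gt0//= ler_pdivrMr//; lra.
have dd : 0 < d <= 1 by rewrite divr_gt0//= ler_pdivrMr//; lra.
have := @three_block p h q d m2 v2 yl yh.
rewrite /= v1E v3E c12E c13E' c23E m3E phE; apply => //.
- by rewrite divr_ge0 ?sqr_ge0// ltW.
- by rewrite divr_ge0 ?sqr_ge0// ltW.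
- by rewrite yl1 subr_ge0 ler_pdivrMr// c23m.
- by rewrite yh0 /yh -lerBrDl ler_pdivrMr// mulrC c12m.
Qed.

(** With all three bounds tight, yl = 0 and yh = 1, and the condition left for the middle block is
    m2^2 + v2 <= m2. *)
Lemma tight_chain m1 m2 m3 v1 v2 v3 c12 c13 c23 :
  0 < m1 -> m3 < 1 -> 0 <= v1 <= m1 * (1 - m1) -> v2 <= m2 * (1 - m2) ->
  0 <= v3 <= m3 * (1 - m3) ->
  c12 = m1 * (1 - m2) -> c23 = m2 * (1 - m3) -> c13 = m1 * (1 - m3) ->
  cov_psd v1 v2 v3 c12 c13 c23 ->
  law3 m1 m2 m3 v1 v2 v3 c12 c13 c23.
Proof.
move=> m10 m31 v1m v2m v3m c12E c23E c13E psd.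
have m1N0 : m1 != 0 by rewrite gt_eqF.
have m3N0 : 1 - m3 != 0 by rewrite gt_eqF// subr_gt0.
have ylE : m2 - c23 / (1 - m3) = 0 by rewrite c23E; field.
have yhE : m2 + c12 / m1 = 1 by rewrite c12E; field.
apply: tight_pair; rewrite ?ylE ?yhE ?ler01 ?lexx ?c12E ?c23E// -?c12E -?c23E//.
by move=> _; rewrite expr0n /= expr1n !mulr0 !mulr1 subr0; lra.
Qed.

(* The second variable is [alpha] times the first plus [beta] times the third, up
   to a constant: it is monotone along the chain of three points. *)
Lemma tight_singular m1 m2 m3 v1 v2 v3 c12 c13 c23 alpha beta :
  0 < m1 -> m3 < 1 -> 0 <= v1 <= m1 * (1 - m1) -> 0 <= v3 <= m3 * (1 - m3) ->
  c12 <= m1 * (1 - m2) -> c23 <= m2 * (1 - m3) -> c13 = m1 * (1 - m3) ->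
  0 <= alpha -> 0 <= beta ->
  c12 = alpha * v1 + beta * c13 -> c23 = alpha * c13 + beta * v3 ->
  v2 = alpha * c12 + beta * c23 ->
  cov_psd v1 v2 v3 c12 c13 c23 ->
  law3 m1 m2 m3 v1 v2 v3 c12 c13 c23.
Proof.
move=> m10 m31 v1m v3m c12m c23m c13E al0 be0 c12E c23E v2E psd.
have m31' : 0 < 1 - m3 by rewrite subr_gt0.
have /andP[v10 _] := v1m; have /andP[v30 _] := v3m.
have s1 : 0 < m1 ^+ 2 + v1 by rewrite ltr_pwDl// exprn_gt0.
have s3 : 0 < (1 - m3) ^+ 2 + v3 by rewrite ltr_pwDl// exprn_gt0.
have m1N0 : m1 != 0 by rewrite gt_eqF.
have m3N0 : 1 - m3 != 0 by rewrite gt_eqF.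
have s1N0 : m1 ^+ 2 + v1 != 0 by rewrite gt_eqF.
have s3N0 : (1 - m3) ^+ 2 + v3 != 0 by rewrite gt_eqF.
(* The value of m2 + alpha (x1 - m1) + beta (x3 - m3) at the middle point (0, 1). It lies between yl
   >= 0 and yh <= 1, and the moments left to the middle block are those of a point mass there. *)
pose ym := m2 - alpha * m1 + beta * (1 - m3).
pose yl := m2 - c23 / (1 - m3); pose yh := m2 + c12 / m1.
have yl0 : 0 <= yl by rewrite subr_ge0 ler_pdivrMr.
have yh1 : yh <= 1 by rewrite -lerBrDl ler_pdivrMr// mulrC.
have ylm : yl <= ym.
  rewrite -subr_ge0 (_ : _ - _ = beta * ((1 - m3) ^+ 2 + v3) / (1 - m3)).
    by rewrite divr_ge0 ?mulr_ge0// ltW.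
  by rewrite /ym /yl c23E c13E; field.
have ymh : ym <= yh.
  rewrite -subr_ge0 (_ : _ - _ = alpha * (m1 ^+ 2 + v1) / m1).
    by rewrite divr_ge0 ?mulr_ge0// ltW.
  by rewrite /ym /yh c12E c13E; field.
have ym0 : 0 <= ym by exact: le_trans ylm.
have ym1 : ym <= 1 by exact: le_trans yh1.
apply: tight_pair => //; first exact: le_trans ym1.
  exact: le_trans ymh.
set p := _ / _; set q := _ / (_ + v3) => r0; rewrite -/yl -/yh.
have aE : m2 - q * yl - p * yh = (1 - p - q) * ym.
  by rewrite /p /q /yl /yh /ym c12E c23E c13E; field; rewrite m1N0 m3N0 s1N0 s3N0.
have bE : m2 ^+ 2 + v2 - q * yl ^+ 2 - p * yh ^+ 2 = (1 - p - q) * ym ^+ 2.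
  rewrite /p /q /yl /yh /ym v2E c12E c23E c13E; field.
  by rewrite m1N0 m3N0 s1N0 s3N0.
by rewrite aE bE ler_wpM2l// expr2 ler_piMl.
Qed.

End ThreeVariables.

(** * Maximal triples of correlations under upper bounds *)

Section Correlations.
Context {R : realType}.
Implicit Types x y z X Y Z : R.

(** Determinant of the correlation matrix with entries x, y, z in positions 12, 13, 23. *)
Definition corr_det x y z := 1 + 2 * x * y * z - x ^+ 2 - y ^+ 2 - z ^+ 2.

(** Positive semidefiniteness of that matrix, expressed by its principal minors. *)
Definition corr3 x y z :=
  [/\ x ^+ 2 <= 1, y ^+ 2 <= 1, z ^+ 2 <= 1 & 0 <= corr_det x y z].

Definition corr3_maximal (X Y Z x y z : R) :=
  [/\ corr3 x y z, x <= X, y <= Y, z <= Z &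
    forall x' y' z', corr3 x' y' z' ->
      x <= x' <= X -> y <= y' <= Y -> z <= z' <= Z ->
      [/\ x' = x, y' = y & z' = z]].

(* The Gram vectors of the correlation matrix are coplanar, the third one lying in
   the cone spanned by the first two, whose correlation [x] reaches its bound. *)
Definition corr3_between (X x y z : R) :=
  [/\ x = X, x ^+ 2 < 1, corr_det x y z = 0, x * z <= y & x * y <= z].

Lemma corr3_swap_yz x y z : corr3 x y z -> corr3 x z y.
Proof.
by move=> [? ? ? d0]; split=> //; apply: le_trans d0 _; rewrite /corr_det; lra.
Qed.

Lemma corr3_swap_xy x y z : corr3 x y z -> corr3 y x z.
Proof.
by move=> [? ? ? d0]; split=> //; apply: le_trans d0 _; rewrite /corr_det; lra.
Qed.

Lemma corr3_maximal_swap_yz X Y Z x y z :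
  corr3_maximal X Y Z x y z -> corr3_maximal X Z Y x z y.
Proof.
move=> [c xX yY zZ max]; split=> // [|x' y' z' c' hx hy hz].
  exact: corr3_swap_yz.
by have [] := max _ _ _ (corr3_swap_yz c') hx hz hy.
Qed.

Lemma corr3_maximal_swap_xy X Y Z x y z :
  corr3_maximal X Y Z x y z -> corr3_maximal Y X Z y x z.
Proof.
move=> [c xX yY zZ max]; split=> // [|x' y' z' c' hx hy hz].
  exact: corr3_swap_xy.
by have [] := max _ _ _ (corr3_swap_xy c') hy hx hz.
Qed.

Lemma corr_det_yz x y z : corr_det x z y = corr_det x y z.
Proof. by rewrite /corr_det; ring. Qed.

Lemma corr_det_xy x y z : corr_det y x z = corr_det x y z.
Proof. by rewrite /corr_det; ring. Qed.

Lemma corr_detE x y z :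
  corr_det x y z = (1 - y ^+ 2) * (1 - z ^+ 2) - (x - y * z) ^+ 2.
Proof. by rewrite /corr_det; ring. Qed.

Lemma sqr_le1 x : (x ^+ 2 <= 1) = (-1 <= x <= 1).
Proof. by apply/idP/andP => [x1|[x0 x1]]; [split|]; nra. Qed.

Lemma ler_sqrt_abs x (u : R) : 0 <= u -> (x ^+ 2 <= u) = (`|x| <= Num.sqrt u).
Proof.
by move=> u0; rewrite -(real_normK (num_real x)) -{1}(sqr_sqrtr u0) ler_pXn2r// nnegrE// sqrtr_ge0.
Qed.

(** For fixed y and z the determinant allows exactly the x in [y z - e, y z + e]. Raising x to the
    smaller of X and y z + e must change nothing, and the determinant vanishes at the upper end. *)
Lemma corr3_maximal_coord X Y Z x y z : corr3_maximal X Y Z x y z ->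
  x = X \/ corr_det x y z = 0 /\ y * z <= x.
Proof.
move=> [[x1 y1 z1 d0] xX yY zZ max].
pose u := (1 - y ^+ 2) * (1 - z ^+ 2); pose e := Num.sqrt u.
have u0 : 0 <= u by rewrite mulr_ge0// subr_ge0.
have e0 : 0 <= e := sqrtr_ge0 _.
have e2 : e ^+ 2 = u by rewrite sqr_sqrtr.
have /andP[xlo xhi] : - e <= x - y * z <= e.
  by rewrite -ler_norml -ler_sqrt_abs// -subr_ge0 -corr_detE.
(* Needed for the raised x to stay at most 1. By the arithmetic-geometric inequality 2 e <= 2 - y^2
   - z^2, so y z + e <= 1 - (y - z)^2 / 2. *)
have eyz1 : y * z + e <= 1.
  have yz := sqr_ge0 (y - z); have y0 := sqr_ge0 y; have z0 := sqr_ge0 z.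
  have : (2 * e) ^+ 2 <= (2 - y ^+ 2 - z ^+ 2) ^+ 2.
    rewrite exprMn e2 /u -subr_ge0 (_ : _ - _ = (y ^+ 2 - z ^+ 2) ^+ 2) ?sqr_ge0//.
    by ring.
  have yz2 : 0 <= 2 - y ^+ 2 - z ^+ 2 by move: y1 z1; lra.
  by rewrite ler_pXn2r ?nnegrE// ?mulr_ge0//; move: yz; rewrite sqrrB; lra.
pose x' := Num.min X (y * z + e).
have xx' : x <= x' by rewrite le_min xX; lra.
have x'e : x' <= y * z + e by rewrite ge_min lexx orbT.
have x'X : x' <= X by rewrite ge_min lexx.
have c' : corr3 x' y z.
  split=> //.
    by move: x1; rewrite !sqr_le1; lra.
  by rewrite corr_detE subr_ge0 -/u ler_sqrt_abs// ler_norml -/e; lra.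
have [x'x _ _] := max _ _ _ c' (introT andP (conj xx' x'X))
  (introT andP (conj (lexx y) yY)) (introT andP (conj (lexx z) zZ)).
move: x'x; rewrite /x'; case: (leP X (y * z + e)) => _ xE; first by left.
right; rewrite -xE lerDl e0; split=> //.
by rewrite corr_detE [_ + e]addrC addrK e2 subrr.
Qed.

Lemma corr3_betweenC X x y z : corr3_between X x y z -> corr3_between X x z y.
Proof. by move=> [xX x1 d0 hy hz]; split=> //; rewrite corr_det_yz. Qed.

(** When x = 1 the determinant is - (z - y)^2, so y = z. Both can be raised together to the least of
    Y, Z and 1, and maximality makes them equal to it. *)
Lemma corr3_maximal_1 X Y Z x y z : 0 < Y -> 0 < Z ->
  corr3_maximal X Y Z x y z -> x = 1 ->
  [/\ x = 1, y = 1 & z = 1] \/ corr3_between Y y x z \/ corr3_between Z z x y.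
Proof.
move=> Y0 Z0 [[_ y1 z1 d0] xX yY zZ max] x1; rewrite x1 in d0 xX max *.
have zE : z = y.
  have dE : corr_det 1 y z = - (z - y) ^+ 2 by rewrite /corr_det; ring.
  apply/eqP; rewrite -subr_eq0 -sqrf_eq0 eq_le sqr_ge0 andbT.
  by move: d0; rewrite dE oppr_ge0.
subst z; pose t := Num.min Y (Num.min Z 1).
have y11 : -1 <= y <= 1 by rewrite -sqr_le1.
have yt : y <= t by rewrite !le_min yY zZ; lra.
have tY : t <= Y by rewrite ge_min lexx.
have tZ : t <= Z by rewrite !ge_min lexx orbT.
have t1 : t <= 1 by rewrite !ge_min lexx !orbT.
have det1 s : corr_det 1 s s = 0 by rewrite /corr_det; ring.
have t11 : t ^+ 2 <= 1.
  by rewrite sqr_le1 t1 andbT (le_trans _ yt)//; case/andP: y11.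
have ct : corr3 1 t t by split; rewrite ?expr1n ?det1.
have [_ ty _] : [/\ 1 = 1 :> R, t = y & t = y].
  by apply: max ct _ _ _; rewrite ?lexx ?xX ?yt ?tY ?tZ.
have [yE|yN1] := eqVneq y 1; first by left; rewrite yE.
have between (W : R) : 0 < W -> y = W -> corr3_between W y 1 y.
  move=> W0 yW; split; rewrite ?mulr1//.
  - by rewrite expr_lt1// ?lt_neqAle ?yN1 ?yW ?ltW// -yW; lra.
  - by rewrite corr_det_xy det1.
right; move: ty; rewrite /t; case: leP => _ ty.
  by left; exact: between.
move: ty; case: leP => _ ty; first by right; exact: between.
by rewrite ty eqxx in yN1.
Qed.

(** When x = -1 the determinant forces z = - y. Raising x and the nonpositive one of y, z to 0 gives
    (0, y, 0) or (0, 0, z), again a correlation triple within the positive bounds. *)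
Lemma corr3_maximal_N1 X Y Z x y z : 0 < X -> 0 < Y -> 0 < Z ->
  corr3_maximal X Y Z x y z -> x != -1.
Proof.
move=> X0 Y0 Z0 [[_ y1 z1 d0] xX yY zZ max]; apply/eqP => xE.
rewrite xE in d0 xX max.
have zE : z = - y.
  have dE : corr_det (-1) y z = - (z + y) ^+ 2 by rewrite /corr_det; ring.
  apply/eqP; rewrite -addr_eq0 -sqrf_eq0 eq_le sqr_ge0 andbT.
  by move: d0; rewrite dE oppr_ge0.
have c00 s : s ^+ 2 <= 1 -> corr3 0 s 0.
  move=> s1; split; rewrite ?expr0n/= ?ler01//.
  rewrite (_ : corr_det 0 s 0 = 1 - s ^+ 2) ?subr_ge0//.
  by rewrite /corr_det; ring.
have N10 : (-1 : R) <= (0 : R) <= X by rewrite lerN10 ltW.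
have [y0|y0] := leP 0 y.
  have [] := max _ _ _ (c00 y y1) N10; [by rewrite lexx yY|by lra|].
  by move=> /eqP; lra.
have [] := max _ _ _ (corr3_swap_yz (c00 z z1)) N10; [by lra|by rewrite lexx zZ|].
by move=> /eqP; lra.
Qed.

Definition corr3_extremal (X Y Z x y z : R) :=
  [/\ x = 1, y = 1 & z = 1] \/ [/\ x = X, y = Y & z = Z] \/
  corr3_between X x y z \/ corr3_between Y y x z \/ corr3_between Z z x y.

(** If both alternatives failed, y < x z and x < y z would give y < y z^2, against z^2 < 1. *)
Lemma two_tight X Y x y z : 0 < x -> 0 < y -> x = X -> y = Y ->
  x ^+ 2 < 1 -> y ^+ 2 < 1 -> z ^+ 2 < 1 -> corr_det x y z = 0 -> x * y <= z ->
  corr3_between X x y z \/ corr3_between Y y x z.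
Proof.
move=> x0 y0 xX yY x1 y1 z1 d0 xyz.
have [xzy|yxz] := leP (x * z) y; first by left.
have [yzx|xyz'] := leP (y * z) x.
  right; split; [exact: yY|exact: y1| |exact: yzx|by rewrite mulrC].
  by rewrite corr_det_xy.
have z0 : 0 < z by rewrite -(pmulr_rgt0 _ x0) (lt_trans y0).
have : y < y * z ^+ 2.
  by apply: lt_trans yxz _; rewrite expr2 mulrA ltr_pM2r.
by rewrite ltr_pMr// ltNge (ltW z1).
Qed.

(** Once correlations equal to 1 or -1 are set aside, each coordinate is tight or satisfies the cone
    inequality with zero determinant. With no tight coordinate, the inequalities would force z = x y
    and x = y z, and the determinant would be (1 - y^2) (1 - z^2) > 0. *)
Lemma corr3_maximal_extremal X Y Z x y z : 0 < X -> 0 < Y -> 0 < Z ->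
  corr3_maximal X Y Z x y z -> corr3_extremal X Y Z x y z.
Proof.
move=> X0 Y0 Z0 max; have maxy := corr3_maximal_swap_xy max.
have maxz := corr3_maximal_swap_xy (corr3_maximal_swap_yz max).
have lt1 (u : R) : u ^+ 2 <= 1 -> u != 1 -> u != -1 -> u ^+ 2 < 1.
  by rewrite lt_neqAle sqrf_eq1 => -> /negbTE -> /negbTE ->.
have [[x1 y1 z1 d0] _ _ _ _] := max.
have [xE|/(lt1 _ x1)/(_ (corr3_maximal_N1 X0 Y0 Z0 max)) {}x1] := eqVneq x 1.
  by have [?|[?|?]] := corr3_maximal_1 Y0 Z0 max xE;
    [left|right; right; right; left|do 4!right].
have [yE|/(lt1 _ y1)/(_ (corr3_maximal_N1 Y0 X0 Z0 maxy)) {}y1] := eqVneq y 1.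
  have [[? ? ?]|[?|/corr3_betweenC ?]] := corr3_maximal_1 X0 Z0 maxy yE.
  - by left.
  - by do 2!right; left.
  - by do 4!right.
have [zE|/(lt1 _ z1)/(_ (corr3_maximal_N1 Z0 X0 Y0 maxz)) {}z1] := eqVneq z 1.
  have [[? ? ?]|[/corr3_betweenC ?|/corr3_betweenC ?]] := corr3_maximal_1 X0 Y0 maxz zE.
  - by left.
  - by do 2!right; left.
  - by do 3!right; left.
have hx := corr3_maximal_coord max; have hy := corr3_maximal_coord maxy.
have := corr3_maximal_coord maxz; rewrite corr_det_xy corr_det_yz => hz.
rewrite corr_det_xy in hy.
have x0 : x = X -> 0 < x by move->.
have y0 : y = Y -> 0 < y by move->.
have z0 : z = Z -> 0 < z by move->.
case: hx hy hz => [xX|[d hx]] [yY|[d' hy]] [zZ|[d'' hz]].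
- by right; left.
- have [h|h] := two_tight (x0 xX) (y0 yY) xX yY x1 y1 z1 d'' hz.
    by do 2!right; left.
  by do 3!right; left.
- have d2 : corr_det x z y = 0 by rewrite corr_det_yz.
  have [h|h] := two_tight (x0 xX) (z0 zZ) xX zZ x1 z1 y1 d2 hy.
    by do 2!right; left; exact: corr3_betweenC.
  by do 4!right.
- by do 2!right; left.
- have d2 : corr_det y z x = 0 by rewrite corr_det_yz corr_det_xy.
  have [h|h] := two_tight (y0 yY) (z0 zZ) yY zZ y1 z1 x1 d2 hx.
    by do 3!right; left; exact: corr3_betweenC.
  by do 4!right; exact: corr3_betweenC.
- do 3!right; left; split; [exact: yY|exact: y1| |exact: hx|by rewrite mulrC].
  by rewrite corr_det_xy.
- do 4!right; split; [exact: zZ|exact: z1| |by rewrite mulrC|by rewrite mulrC].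
  by rewrite corr_det_xy corr_det_yz.
- exfalso.
  (* When the determinant vanishes,
     [(x - y z) (y - x z) = - (z - x y) (1 - z^2)]. *)
  have eqv u v w : corr_det u v w = 0 -> v * w <= u -> u * w <= v ->
      u * v <= w -> w ^+ 2 < 1 -> w = u * v.
    move=> d0' hu hv hw w1.
    have h : (w - u * v) * (1 - w ^+ 2) = - ((u - v * w) * (v - u * w)).
      have -> : (w - u * v) * (1 - w ^+ 2) =
        w * corr_det u v w - (u - v * w) * (v - u * w).
        by rewrite /corr_det; ring.
      by rewrite d0' mulr0 sub0r.
    have h0 : (w - u * v) * (1 - w ^+ 2) <= 0.
      by rewrite h oppr_le0 mulr_ge0// subr_ge0.
    by apply/le_anti; rewrite hw andbT -subr_le0 -(pmulr_lle0 _ (_ : 0 < 1 - w ^+ 2)) ?subr_gt0.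
  have zE := eqv x y z d hx hy hz z1.
  have xE : x = y * z.
    apply: eqv => //; first by rewrite corr_det_yz corr_det_xy.
      by rewrite mulrC.
    by rewrite mulrC.
  move: d; rewrite corr_detE -xE subrr expr0n subr0 => /eqP.
  by rewrite mulf_eq0 !subr_eq0 !(eq_sym 1) (lt_eqF y1) (lt_eqF z1).
Qed.

End Correlations.

(** * Raising covariances to those of a law on the cube *)

Section Domination.
Context {R : realType}.
Implicit Types (m s x y z X Y Z a b c : R).

Lemma cov_psd_corr3 s1 s2 s3 x y z : 0 < s1 -> 0 < s2 -> 0 < s3 ->
  cov_psd (s1 ^+ 2) (s2 ^+ 2) (s3 ^+ 2) (s1 * s2 * x) (s1 * s3 * y) (s2 * s3 * z)
  <-> corr3 x y z.
Proof.
move=> s10 s20 s30; split=> [psd|[x1 y1 z1 d0] a b c].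
  have q a b c : 0 <= a ^+ 2 + b ^+ 2 + c ^+ 2 + 2 * (a * b * x + a * c * y + b * c * z).
    have := psd (a / s1) (b / s2) (c / s3).
    rewrite (_ : _ + _ = a ^+ 2 + b ^+ 2 + c ^+ 2 + 2 * (a * b * x + a * c * y + b * c * z))//.
    by field; rewrite !gt_eqF.
  split.
  - by have := q (- x) 1 0; lra.
  - by have := q (- y) 0 1; lra.
  - by have := q 0 (- z) 1; lra.
  - have r0 : 0 <= 1 - x ^+ 2.
      by have := q (- x) 1 0; lra.
    suff : (x * y - z) ^+ 2 <= (1 - x ^+ 2) * (1 - y ^+ 2).
      by rewrite /corr_det; lra.
    apply: quadratic_discr => // g.
    by apply: le_trans (q (- (x * g + y)) g 1) _; lra.
(* Completing the square in the first variable leaves a binary form of determinant [corr_det x y z].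
   If x^2 = 1 its mixed term vanishes; otherwise a second square is completed. *)
have -> : a ^+ 2 * s1 ^+ 2 + b ^+ 2 * s2 ^+ 2 + c ^+ 2 * s3 ^+ 2 +
   2 * (a * b * (s1 * s2 * x) + a * c * (s1 * s3 * y) + b * c * (s2 * s3 * z)) =
   (a * s1 + x * (b * s2) + y * (c * s3)) ^+ 2 +
   ((1 - x ^+ 2) * (b * s2) ^+ 2 + 2 * (z - x * y) * (b * s2) * (c * s3) +
   (1 - y ^+ 2) * (c * s3) ^+ 2) by ring.
rewrite addr_ge0 ?sqr_ge0//; set u := b * s2; set v := c * s3.
move: x1; rewrite -subr_ge0 le_eqVlt => /predU1P[x1|x1].
  have zxy : z - x * y = 0.
    apply/eqP; rewrite -sqrf_eq0 eq_le sqr_ge0 andbT.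
    have : corr_det x y z = (1 - x ^+ 2) * (1 - y ^+ 2) - (z - x * y) ^+ 2.
      by rewrite /corr_det; ring.
    by rewrite -x1 mul0r sub0r => dE; rewrite dE oppr_ge0 in d0.
  by rewrite -x1 zxy mulr0 !mul0r !add0r mulr_ge0 ?sqr_ge0// subr_ge0.
rewrite -(pmulr_rge0 _ x1).
have -> : (1 - x ^+ 2) * ((1 - x ^+ 2) * u ^+ 2 + 2 * (z - x * y) * u * v +
  (1 - y ^+ 2) * v ^+ 2) =
  ((1 - x ^+ 2) * u + (z - x * y) * v) ^+ 2 + corr_det x y z * v ^+ 2.
  by rewrite /corr_det; ring.
by rewrite addr_ge0 ?sqr_ge0// mulr_ge0// sqr_ge0.
Qed.

Lemma ord3P (Q : 'I_3 -> Prop) : Q 0 -> Q 1 -> Q 2%:R -> forall t, Q t.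
Proof.
move=> q0 q1 q2 [[|[|[|//]]] lt3].
- by rewrite (_ : Ordinal _ = 0)//; exact/val_inj.
- by rewrite (_ : Ordinal _ = 1)//; exact/val_inj.
- by rewrite (_ : Ordinal _ = 2%:R)//; exact/val_inj.
Qed.

(** A maximizer of the sum of the coordinates over the compact set of admissible triples above the
    given one is maximal in the componentwise order. *)
Lemma ex_corr3_maximal X Y Z x y z : corr3 x y z -> x <= X -> y <= Y -> z <= Z ->
  exists x' y' z', [/\ x <= x', y <= y', z <= z' & corr3_maximal X Y Z x' y' z'].
Proof.
move=> cxyz xX yY zZ.
pose V := prod_topology (fun _ : 'I_3 => R).
pose K : set V := [set v | corr3 (v 0) (v 1) (v 2%:R)] `&`
  [set v | x <= v 0 <= X] `&` [set v | y <= v 1 <= Y] `&` [set v | z <= v 2%:R <= Z].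
pose mk a b c : V := fun t => [:: a; b; c]`_t.
have ev (t : 'I_3) : continuous (fun v : V => v t) by exact: eval_continuous.
have cst (r : R) : continuous (fun _ : V => r) by exact: continuous_constf.
have sq (t : 'I_3) : continuous (fun v : V => v t ^+ 2).
  exact: continuous_sqrf.
have cdet : continuous (fun v : V => corr_det (v 0) (v 1) (v 2%:R)).
  do 3![apply: continuous_subf; last exact: sq].
  by apply: continuous_addf => //; do 3?apply: continuous_mulf.
have box t a b : closed [set v : V | a <= v t <= b].
  rewrite (_ : mkset _ = [set v : V | a <= v t] `&` [set v : V | v t <= b]).
    by apply: closedI; exact: closed_le_fun.
  by apply/seteqP; split=> v /=; [move=> /andP|move=> ?; apply/andP].
have clK : closed K.
  do 3![apply: closedI; last exact: box].
  rewrite (_ : mkset _ = [set v : V | v 0 ^+ 2 <= 1] `&` [set v : V | v 1 ^+ 2 <= 1] `&`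
     [set v : V | v 2%:R ^+ 2 <= 1] `&` [set v : V | 0 <= corr_det (v 0) (v 1) (v 2%:R)]).
    by do 3?apply: closedI; exact: closed_le_fun.
  by apply/seteqP; split=> v /=; [case|move=> [[[]]]; split].
have K0 : K !=set0.
  exists (mk x y z); split; [split; [split; [exact: cxyz|]|]|]; rewrite /mk /=.
  - by rewrite lexx.
  - by rewrite lexx.
  - by rewrite lexx.
have boxK v : K v -> forall t, -1 <= v t <= 1.
  by move=> [[[[v0 v1 v2 _] _] _] _]; apply: ord3P; rewrite -sqr_le1.
have cf : continuous (fun v : V => v 0 + v 1 + v 2%:R).
  by do 2?apply: continuous_addf.
have [v Kv vmax] := box_argmax K0 clK boxK cf.
have [[[c0 /andP[v0 v0X]] /andP[v1 v1Y]] /andP[v2 v2Z]] := Kv.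
exists (v 0), (v 1), (v 2%:R); split=> //; split=> // x' y' z' c'.
move=> /andP[hx xX'] /andP[hy yY'] /andP[hz zZ'].
have : x' + y' + z' <= v 0 + v 1 + v 2%:R.
  apply: (vmax (mk x' y' z')); split; [split; [split; [exact: c'|]|]|]; rewrite /mk /=.
  - by rewrite xX' (le_trans v0).
  - by rewrite yY' (le_trans v1).
  - by rewrite zZ' (le_trans v2).
by move=> sum_le; split; lra.
Qed.

(** Take a to be the largest s_i / (1 - m_i), reached at k. Then a s_i <= m_i is the hypothesis for
    the pair (i, k). If every s_i is 0, any positive a works. *)
Lemma common_scale (T : finType) (m s : T -> R) :
  (forall i, 0 <= m i <= 1) -> (forall i, 0 <= s i) ->
  (forall i j, s i * s j <= m i * (1 - m j)) ->
  exists2 a, 0 < a & forall i, a * s i <= m i /\ s i <= a * (1 - m i).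
Proof.
move=> m01 s0 sm.
have [/forallP sz|/forallPn[i0 si0]] := boolP [forall i, s i == 0].
  exists 1; first exact: ltr01.
  move=> i; rewrite (eqP (sz i)) mulr0 mul1r subr_ge0.
  by have /andP[] := m01 i.
have {}si0 : 0 < s i0 by rewrite lt_neqAle eq_sym si0 s0.
case: (@arg_maxP _ _ _ i0 xpredT (fun i => s i / (1 - m i)) isT) => k _ kmax.
have m1 i : 0 <= 1 - m i by rewrite subr_ge0; have /andP[] := m01 i.
have mlt1 i : 0 < s i -> 0 < 1 - m i.
  move=> si; rewrite lt_neqAle eq_sym m1 andbT; apply/negP => /eqP mi1.
  by have := sm i i; rewrite mi1 mulr0 leNgt mulr_gt0.
have a0 : 0 < s k / (1 - m k).
  by apply: lt_le_trans (kmax i0 isT); rewrite divr_gt0// mlt1.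
have sk : 0 < s k.
  rewrite lt_neqAle eq_sym s0 andbT; apply/negP => /eqP sk0.
  by rewrite sk0 mul0r ltxx in a0.
exists (s k / (1 - m k)) => // i; split.
  by rewrite mulrAC ler_pdivrMr ?mlt1// mulrC sm.
have [si|] := ltP 0 (s i); first by rewrite -ler_pdivrMr ?mlt1//; exact: kmax.
by move=> si; apply: le_trans si _; rewrite mulr_ge0 ?(ltW a0).
Qed.

Definition corrlaw m1 m2 m3 s1 s2 s3 x y z :=
  law3 m1 m2 m3 (s1 ^+ 2) (s2 ^+ 2) (s3 ^+ 2) (s1 * s2 * x) (s1 * s3 * y) (s2 * s3 * z).

Lemma corrlaw_swap12 m1 m2 m3 s1 s2 s3 x y z :
  corrlaw m2 m1 m3 s2 s1 s3 x z y -> corrlaw m1 m2 m3 s1 s2 s3 x y z.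
Proof. by rewrite /corrlaw (mulrC s2 s1); exact: law3_swap12. Qed.

Lemma corrlaw_swap23 m1 m2 m3 s1 s2 s3 x y z :
  corrlaw m1 m3 m2 s1 s3 s2 y x z -> corrlaw m1 m2 m3 s1 s2 s3 x y z.
Proof. by rewrite /corrlaw (mulrC s3 s2); exact: law3_swap23. Qed.

(** This is min(m, m') - m m': the entrywise bound of the semidefinite program, used in both orders
    and written for covariances. *)
Definition cov_bound m m' := Num.min (m * (1 - m')) (m' * (1 - m)).

Lemma cov_boundC m m' : cov_bound m m' = cov_bound m' m.
Proof. by rewrite /cov_bound minC. Qed.

Lemma cov_boundE m m' : m <= m' -> cov_bound m m' = m * (1 - m').
Proof. by move=> mm'; apply/min_idPl; lra. Qed.

(* The three variables are increasing affine functions of a common variable taking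
   the values [-a] and [1 / a] with masses [1 / (1 + a^2)] and [a^2 / (1 + a^2)]. *)
Lemma comonotone_law m1 m2 m3 s1 s2 s3 :
  0 <= m1 <= 1 -> 0 <= m2 <= 1 -> 0 <= m3 <= 1 ->
  0 <= s1 -> 0 <= s2 -> 0 <= s3 ->
  s1 ^+ 2 <= m1 * (1 - m1) -> s2 ^+ 2 <= m2 * (1 - m2) ->
  s3 ^+ 2 <= m3 * (1 - m3) ->
  s1 * s2 <= cov_bound m1 m2 -> s1 * s3 <= cov_bound m1 m3 ->
  s2 * s3 <= cov_bound m2 m3 ->
  corrlaw m1 m2 m3 s1 s2 s3 1 1 1.
Proof.
move=> m1b m2b m3b s1b s2b s3b v1 v2 v3.
rewrite !le_min => /andP[b12 b21] /andP[b13 b31] /andP[b23 b32].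
pose m (i : 'I_3) := [:: m1; m2; m3]`_i.
pose s (i : 'I_3) := [:: s1; s2; s3]`_i.
have m01 : forall i, 0 <= m i <= 1 by exact: ord3P.
have s0 : forall i, 0 <= s i by exact: ord3P.
have sm : forall i j, s i * s j <= m i * (1 - m j).
  by do 2?apply: ord3P; rewrite /m /s /= -?expr2// mulrC.
have [a a0 as_] := common_scale m01 s0 sm.
have aN0 : a != 0 by rewrite gt_eqF.
pose t := 1 + a ^+ 2.
have t0 : 0 < t by rewrite ltr_pwDl// sqr_ge0.
have tN0 : t != 0 by rewrite gt_eqF.
have range (i : 'I_3) (k : bool) : 0 <= (if k then m i + s i / a else m i - a * s i) <= 1.
  have [lo hi] := as_ i; have /andP[mi0 mi1] := m01 i; case: k.
    by rewrite addr_ge0 ?divr_ge0 ?(ltW a0)//= -lerBrDl ler_pdivrMr// mulrC.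
  rewrite subr_ge0 lo /= (le_trans _ mi1)// gerBl mulr_ge0// ltW//.
exists bool, (fun k => if k then a ^+ 2 / t else t^-1),
  (fun k => if k then m1 + s1 / a else m1 - a * s1),
  (fun k => if k then m2 + s2 / a else m2 - a * s2),
  (fun k => if k then m3 + s3 / a else m3 - a * s3).
have mean mi si : a ^+ 2 / t * (mi + si / a) + t^-1 * (mi - a * si) = mi.
  by move: tN0; rewrite /t => tN0'; field; rewrite aN0 tN0'.
have second mi si mj sj :
    a ^+ 2 / t * ((mi + si / a) * (mj + sj / a)) +
    t^-1 * ((mi - a * si) * (mj - a * sj)) = mi * mj + si * sj.
  by move: tN0; rewrite /t => tN0'; field; rewrite aN0 tN0'.
split.
- by case; rewrite ?divr_ge0 ?invr_ge0 ?sqr_ge0 ?(ltW t0).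
- by rewrite big_bool /= -[X in _ + X]mul1r -mulrDl addrC divff.
- by move=> k; split; [exact: (range 0)|exact: (range 1)|exact: (range 2%:R)].
- by rewrite !big_bool /= !mean.
- by rewrite !big_bool /= !second !mulr1.
Qed.

Definition cube_var m s := [/\ 0 < m < 1, 0 < s & s ^+ 2 <= m * (1 - m)].

Definition all_tight m1 m2 m3 s1 s2 s3 x y z :=
  [/\ s1 * s2 * x = cov_bound m1 m2, s1 * s3 * y = cov_bound m1 m3,
      s2 * s3 * z = cov_bound m2 m3 & corr3 x y z].

Lemma all_tight_swap12 m1 m2 m3 s1 s2 s3 x y z :
  all_tight m1 m2 m3 s1 s2 s3 x y z -> all_tight m2 m1 m3 s2 s1 s3 x z y.
Proof.
move=> [hx hy hz c]; split=> //; last exact: corr3_swap_yz.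
by rewrite cov_boundC (mulrC s2).
Qed.

Lemma all_tight_swap23 m1 m2 m3 s1 s2 s3 x y z :
  all_tight m1 m2 m3 s1 s2 s3 x y z -> all_tight m1 m3 m2 s1 s3 s2 y x z.
Proof.
move=> [hx hy hz c]; split=> //; last exact: corr3_swap_xy.
by rewrite cov_boundC (mulrC s3).
Qed.

(** Relabelling sorts the means, after which each [cov_bound] has the form that [tight_chain] asks
    for. *)
Lemma all_tight_law m1 m2 m3 s1 s2 s3 x y z :
  cube_var m1 s1 -> cube_var m2 s2 -> cube_var m3 s3 ->
  all_tight m1 m2 m3 s1 s2 s3 x y z -> corrlaw m1 m2 m3 s1 s2 s3 x y z.
Proof.
have sorted u1 u2 u3 t1 t2 t3 a b c : u1 <= u2 -> u2 <= u3 ->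
    cube_var u1 t1 -> cube_var u2 t2 -> cube_var u3 t3 ->
    all_tight u1 u2 u3 t1 t2 t3 a b c -> corrlaw u1 u2 u3 t1 t2 t3 a b c.
  move=> u12 u23 [/andP[u10 _] t10 v1] [_ t20 v2] [/andP[_ u31] t30 v3] [ha hb hc c3].
  apply: tight_chain; rewrite ?sqr_ge0//.
  - by rewrite ha cov_boundE.
  - by rewrite hc cov_boundE.
  - by rewrite hb cov_boundE// (le_trans u12).
  - exact/cov_psd_corr3.
move=> h1 h2 h3 h.
have [m12|/ltW m21] := leP m1 m2; have [m13|/ltW m31] := leP m1 m3;
  have [m23|/ltW m32] := leP m2 m3.
- exact: sorted.
- exact/corrlaw_swap23/sorted/all_tight_swap23.
- exact: sorted.
- exact/corrlaw_swap23/corrlaw_swap12/sorted/all_tight_swap12/all_tight_swap23.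
- exact/corrlaw_swap12/sorted/all_tight_swap12.
- exact/corrlaw_swap12/sorted/all_tight_swap12.
- exact/corrlaw_swap12/corrlaw_swap23/sorted/all_tight_swap23/all_tight_swap12.
- apply/corrlaw_swap12/corrlaw_swap23/corrlaw_swap12/sorted => //.
  exact/all_tight_swap12/all_tight_swap23/all_tight_swap12.
Qed.

(** Zero determinant makes the third variable an affine combination of the first two, whose
    covariance is tight: [tight_singular] applies with the last two variables exchanged. *)
Lemma between_law m1 m2 m3 s1 s2 s3 x y z :
  cube_var m1 s1 -> cube_var m2 s2 -> cube_var m3 s3 -> corr3 x y z ->
  s1 * s3 * y <= cov_bound m1 m3 -> s2 * s3 * z <= cov_bound m2 m3 ->
  corr3_between (cov_bound m1 m2 / (s1 * s2)) x y z ->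
  corrlaw m1 m2 m3 s1 s2 s3 x y z.
Proof.
have sorted u1 u2 u3 t1 t2 t3 a b c : u1 <= u2 ->
    cube_var u1 t1 -> cube_var u2 t2 -> cube_var u3 t3 -> corr3 a b c ->
    t1 * t3 * b <= cov_bound u1 u3 -> t2 * t3 * c <= cov_bound u2 u3 ->
    corr3_between (cov_bound u1 u2 / (t1 * t2)) a b c ->
    corrlaw u1 u2 u3 t1 t2 t3 a b c.
  move=> u12 [/andP[u10 _] t10 v1] [/andP[_ u21] t20 v2] [_ t30 v3] c3 hb hc [aE a1 d0 acb abc].
  have a1N0 : 1 - a ^+ 2 != 0 by rewrite subr_eq0 eq_sym lt_eqF.
  have [t1N0 t2N0] : t1 != 0 /\ t2 != 0 by rewrite !gt_eqF.
  (* The coefficients come from regressing the third variable on the first two; the cone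
     inequalities make them nonnegative. *)
  apply/corrlaw_swap23/(@tight_singular _ _ _ _ _ _ _ _ _ _
    ((b - a * c) / (1 - a ^+ 2) * (t3 / t1)) ((c - a * b) / (1 - a ^+ 2) * (t3 / t2))).
  - by [].
  - by [].
  - by rewrite sqr_ge0.
  - by rewrite sqr_ge0.
  - by apply: le_trans hb _; rewrite ge_min lexx.
  - by rewrite (mulrC t3); apply: le_trans hc _; rewrite ge_min lexx orbT.
  - by rewrite aE -cov_boundE//; field; rewrite t1N0 t2N0.
  - by rewrite !mulr_ge0 ?invr_ge0 ?subr_ge0 ?(ltW t10) ?(ltW t30) ?(ltW a1).
  - by rewrite !mulr_ge0 ?invr_ge0 ?subr_ge0 ?(ltW t20) ?(ltW t30) ?(ltW a1).
  - by field; rewrite a1N0 t1N0 t2N0.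
  - by field; rewrite a1N0 t1N0 t2N0.
  - apply/eqP; rewrite -subr_eq0; apply/eqP.
    transitivity (t3 ^+ 2 * corr_det a b c / (1 - a ^+ 2)).
      by rewrite /corr_det; field; rewrite a1N0 t1N0 t2N0.
    by rewrite d0 mulr0 mul0r.
  - by apply/cov_psd_corr3 => //; exact: corr3_swap_xy.
move=> h1 h2 h3 c hy hz btw.
have [m12|/ltW m21] := leP m1 m2; first exact: sorted.
apply/corrlaw_swap12/sorted => //; first exact: corr3_swap_yz.
by rewrite cov_boundC (mulrC s2); exact: corr3_betweenC.
Qed.

Definition dominated m1 m2 m3 s1 s2 s3 c12 c13 c23 :=
  exists c12' c13' c23', [/\ c12 <= c12', c13 <= c13', c23 <= c23' &
    law3 m1 m2 m3 (s1 ^+ 2) (s2 ^+ 2) (s3 ^+ 2) c12' c13' c23'].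

Lemma dominated_pos m1 m2 m3 s1 s2 s3 c12 c13 c23 :
  cube_var m1 s1 -> cube_var m2 s2 -> cube_var m3 s3 ->
  cov_psd (s1 ^+ 2) (s2 ^+ 2) (s3 ^+ 2) c12 c13 c23 ->
  c12 <= cov_bound m1 m2 -> c13 <= cov_bound m1 m3 -> c23 <= cov_bound m2 m3 ->
  dominated m1 m2 m3 s1 s2 s3 c12 c13 c23.
Proof.
move=> h1 h2 h3 psd hx hy hz.
have [/andP[m10 m11] s10 v1] := h1; have [/andP[m20 m21] s20 v2] := h2.
have [/andP[m30 m31] s30 v3] := h3.
have [s1N0 s2N0 s3N0] : [/\ s1 != 0, s2 != 0 & s3 != 0] by rewrite !gt_eqF.
have s12 : 0 < s1 * s2 by rewrite mulr_gt0.
have s13 : 0 < s1 * s3 by rewrite mulr_gt0.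
have s23 : 0 < s2 * s3 by rewrite mulr_gt0.
have bound0 m m' : 0 < m < 1 -> 0 < m' < 1 -> 0 < cov_bound m m'.
  move=> /andP[m0 m1'] /andP[m'0 m'1].
  by rewrite lt_min !mulr_gt0// subr_gt0.
pose X := cov_bound m1 m2 / (s1 * s2); pose Y := cov_bound m1 m3 / (s1 * s3).
pose Z := cov_bound m2 m3 / (s2 * s3).
have X0 : 0 < X by rewrite divr_gt0// bound0// ?m10 ?m20.
have Y0 : 0 < Y by rewrite divr_gt0// bound0// ?m10 ?m30.
have Z0 : 0 < Z by rewrite divr_gt0// bound0// ?m20 ?m30.
have c3 : corr3 (c12 / (s1 * s2)) (c13 / (s1 * s3)) (c23 / (s2 * s3)).
  apply/(cov_psd_corr3 _ _ _ s10 s20 s30).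
  by rewrite ![_ * (_ / _)]mulrC !divfK ?gt_eqF.
have [|||x [y [z [xx' yy' zz' max]]]] := ex_corr3_maximal (X := X) (Y := Y) (Z := Z) c3.
- by rewrite ler_pM2r ?invr_gt0.
- by rewrite ler_pM2r ?invr_gt0.
- by rewrite ler_pM2r ?invr_gt0.
exists (s1 * s2 * x), (s1 * s3 * y), (s2 * s3 * z); split.
- by rewrite mulrC -ler_pdivrMr.
- by rewrite mulrC -ler_pdivrMr.
- by rewrite mulrC -ler_pdivrMr.
have [cm xX yY zZ _] := max.
have hX : s1 * s2 * x <= cov_bound m1 m2 by rewrite mulrC -ler_pdivlMr.
have hY : s1 * s3 * y <= cov_bound m1 m3 by rewrite mulrC -ler_pdivlMr.
have hZ : s2 * s3 * z <= cov_bound m2 m3 by rewrite mulrC -ler_pdivlMr.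
have [[x1 y1 z1]|[[xE yE zE]|[bx|[by_|bz]]]] := corr3_maximal_extremal X0 Y0 Z0 max.
- rewrite x1 y1 z1 !mulr1 in hX hY hZ; rewrite x1 y1 z1.
  by apply: comonotone_law => //; rewrite ?(ltW m10) ?(ltW m20) ?(ltW m30) ?ltW.
- apply: all_tight_law => //; split=> //.
  + by rewrite xE mulrC divfK// gt_eqF.
  + by rewrite yE mulrC divfK// gt_eqF.
  + by rewrite zE mulrC divfK// gt_eqF.
- exact: between_law.
- apply/corrlaw_swap23/between_law => //; first exact: corr3_swap_xy.
  by rewrite cov_boundC (mulrC s3).
- apply/corrlaw_swap12/corrlaw_swap23/between_law => //.
  + exact/corr3_swap_xy/corr3_swap_yz.
  + by rewrite cov_boundC (mulrC s2).
  + by rewrite cov_boundC (mulrC s3).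
Qed.

Lemma dominated_swap12 m1 m2 m3 s1 s2 s3 c12 c13 c23 :
  dominated m2 m1 m3 s2 s1 s3 c12 c23 c13 -> dominated m1 m2 m3 s1 s2 s3 c12 c13 c23.
Proof.
move=> [a [b [c [ha hb hc /law3_swap12 l]]]].
by exists a, c, b.
Qed.

Lemma dominated_swap23 m1 m2 m3 s1 s2 s3 c12 c13 c23 :
  dominated m1 m3 m2 s1 s3 s2 c13 c12 c23 -> dominated m1 m2 m3 s1 s2 s3 c12 c13 c23.
Proof.
move=> [a [b [c [ha hb hc /law3_swap23 l]]]].
by exists b, a, c.
Qed.

Lemma cube_var_pos m s : 0 <= m <= 1 -> 0 < s -> s ^+ 2 <= m * (1 - m) ->
  cube_var m s.
Proof.
move=> /andP[m0 m1] s0 v; split=> //.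
have : 0 < m * (1 - m) by apply: lt_le_trans v; rewrite exprn_gt0.
rewrite !lt_neqAle m0 m1 !andbT => /andP[+ _].
by rewrite eq_sym mulf_eq0 negb_or subr_eq0 (eq_sym 1) (eq_sym m 0).
Qed.

(** Zero variance kills c13 and c23. Then c12 is raised to the smaller of s1 s2, reached by a
    comonotone law, and m1 (1 - m2), reached by a tight pair. *)
Lemma dominated0 m1 m2 m3 s1 s2 c12 c13 c23 :
  0 <= m1 <= 1 -> 0 <= m2 <= 1 -> 0 <= m3 <= 1 -> 0 <= s1 -> 0 <= s2 ->
  s1 ^+ 2 <= m1 * (1 - m1) -> s2 ^+ 2 <= m2 * (1 - m2) ->
  cov_psd (s1 ^+ 2) (s2 ^+ 2) (0 ^+ 2) c12 c13 c23 ->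
  c12 <= cov_bound m1 m2 ->
  dominated m1 m2 m3 s1 s2 0 c12 c13 c23.
Proof.
wlog m12 : m1 m2 s1 s2 c12 c13 c23 / m1 <= m2 => [wl|].
  have [m12|/ltW m21] := leP m1 m2; first exact: wl.
  move=> m1b m2b m3b s1b s2b v1 v2 psd b; apply: dominated_swap12.
  by apply: wl => //; [exact: cov_psd_swap12|rewrite cov_boundC].
move=> m1b m2b m3b s1b s2b v1 v2 psd; rewrite cov_boundE// => b.
have quad0 (r a : R) : 0 <= r -> (forall g, 0 <= r * g ^+ 2 - 2 * g * a + 0) -> a = 0.
  move=> r0 /(quadratic_discr r0); rewrite mulr0 => a0.
  by apply/eqP; rewrite -sqrf_eq0 eq_le a0 sqr_ge0.
have c13E : c13 = 0.
  apply: (@quad0 (s1 ^+ 2)) => [|g]; first exact: sqr_ge0.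
  by apply: le_trans (psd g 0 (- 1)) _; lra.
have c23E : c23 = 0.
  apply: (@quad0 (s2 ^+ 2)) => [|g]; first exact: sqr_ge0.
  by apply: le_trans (psd 0 g (- 1)) _; lra.
have c12s : c12 <= s1 * s2.
  have : c12 ^+ 2 <= (s1 * s2) ^+ 2.
    rewrite exprMn; apply: quadratic_discr => [|g]; first exact: sqr_ge0.
    by apply: le_trans (psd g (- 1) 0) _; lra.
  by rewrite ler_sqrt_abs ?sqr_ge0// sqrtr_sqr (ger0_norm (mulr_ge0 s1b s2b)) ler_norml => /andP[].
have cb3 m m' : 0 <= m <= 1 -> 0 <= m' <= 1 -> 0 <= cov_bound m m'.
  move=> /andP[h0 h1] /andP[h'0 h'1].
  by rewrite le_min !mulr_ge0// subr_ge0.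
have [s12|s12] := leP (s1 * s2) (m1 * (1 - m2)).
  have /andP[m30 m31] := m3b.
  have v3 : 0 ^+ 2 <= m3 * (1 - m3) by rewrite expr0n mulr_ge0// subr_ge0.
  have := comonotone_law m1b m2b m3b s1b s2b (lexx 0) v1 v2 v3.
  rewrite !mulr0 cov_boundE// => /(_ s12 (cb3 _ _ m1b m3b) (cb3 _ _ m2b m3b)).
  rewrite /corrlaw !mulr0 !mul0r !mulr1 => l.
  by exists (s1 * s2), 0, 0; rewrite c13E c23E lexx.
have t0 : 0 <= m1 * (1 - m2) by rewrite -cov_boundE//; exact: cb3.
have s12_gt0 : 0 < s1 * s2 by exact: le_lt_trans s12.
have s10 : 0 < s1.
  by rewrite lt_neqAle s1b eq_sym andbT; apply: contraTneq s12_gt0 => ->; rewrite mul0r ltxx.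
have s20 : 0 < s2 by rewrite -(pmulr_rgt0 _ s10).
have [/andP[m10 _] _ _] := cube_var_pos m1b s10 v1.
have [/andP[_ m21] _ _] := cube_var_pos m2b s20 v2.
have /andP[m30 m31] := m3b.
exists (m1 * (1 - m2)), 0, 0; rewrite c13E c23E lexx; split=> //.
(* The constant variable takes the place of the combination, with both coefficients 0. *)
apply/law3_swap23/(@tight_singular _ _ _ _ _ _ _ _ _ _ 0 0);
  rewrite ?mul0r ?addr0 ?expr0n ?sqr_ge0//=.
- by rewrite mulr_ge0 ?subr_ge0// ltW.
- by rewrite mulr_ge0 ?subr_ge0// ltW.
- move=> a b' c; rewrite !mulr0 !(addr0, add0r).
  have [ac|ac] := leP 0 (a * c).
    apply: addr_ge0; last exact: mulr_ge0 (ler0n _ 2) (mulr_ge0 ac t0).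
    by apply: addr_ge0; apply: mulr_ge0; exact: sqr_ge0.
  have := sqr_ge0 (a * s1 + c * s2).
  have : 0 <= (- (a * c)) * (s1 * s2 - m1 * (1 - m2)).
    by rewrite mulr_ge0 ?oppr_ge0 ?subr_ge0// ltW.
  by rewrite sqrrD !exprMn; lra.
Qed.

Lemma dominatedP m1 m2 m3 s1 s2 s3 c12 c13 c23 :
  0 <= m1 <= 1 -> 0 <= m2 <= 1 -> 0 <= m3 <= 1 -> 0 <= s1 -> 0 <= s2 -> 0 <= s3 ->
  s1 ^+ 2 <= m1 * (1 - m1) -> s2 ^+ 2 <= m2 * (1 - m2) ->
  s3 ^+ 2 <= m3 * (1 - m3) ->
  cov_psd (s1 ^+ 2) (s2 ^+ 2) (s3 ^+ 2) c12 c13 c23 ->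
  c12 <= cov_bound m1 m2 -> c13 <= cov_bound m1 m3 -> c23 <= cov_bound m2 m3 ->
  dominated m1 m2 m3 s1 s2 s3 c12 c13 c23.
Proof.
move=> m1b m2b m3b s1b s2b s3b v1 v2 v3 psd b12 b13 b23.
have pos (s : R) : s != 0 -> 0 <= s -> 0 < s by move=> sN0; rewrite lt_neqAle eq_sym sN0.
have [s30|/pos/(_ s3b) s30] := eqVneq s3 0.
  by rewrite s30 in psd *; exact: dominated0.
have [s20|/pos/(_ s2b) s20] := eqVneq s2 0.
  rewrite s20 in psd *; apply/dominated_swap23/dominated0 => //.
  exact: cov_psd_swap23.
have [s10|/pos/(_ s1b) s10] := eqVneq s1 0.
  rewrite s10 in psd *; apply/dominated_swap12/dominated_swap23/dominated0 => //.
  exact/cov_psd_swap23/cov_psd_swap12.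
by apply: dominated_pos => //; exact: cube_var_pos.
Qed.

End Domination.

(** * The semidefinite relaxation *)

Section Relaxation.
Context {R : realType} {n : nat}.
Implicit Types (A S : 'M[R]_n) (mu sigma : 'cV[R]_n).

(** Nonnegativity of the Schur complement S - mu mu^T of the corner entry 1 in the block matrix. *)
Definition covariance_psd mu S := forall u : 'I_n -> R,
  0 <= \sum_i \sum_j u i * u j * (S i j - mu i 0 * mu j 0).

Lemma block_quadratic mu S (a : R) (u : 'cV[R]_n) :
  ((col_mx a%:M u)^T *m block_mx (1%:M : 'M[R]_1) mu^T mu S *m col_mx a%:M u) 0 0 =
  (a + \sum_i u i 0 * mu i 0) ^+ 2 +
  \sum_i \sum_j u i 0 * u j 0 * (S i j - mu i 0 * mu j 0).
Proof.
rewrite tr_col_mx tr_scalar_mx mul_row_block mul_row_col mulmx1 !mulmxDl.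
have umu : (u^T *m mu) 0 0 = \sum_i u i 0 * mu i 0.
  by rewrite mxE; apply: eq_bigr => i _; rewrite mxE.
have muu : (mu^T *m u) 0 0 = \sum_i u i 0 * mu i 0.
  by rewrite mxE; apply: eq_bigr => i _; rewrite mxE mulrC.
have uSu : (u^T *m S *m u) 0 0 = \sum_i \sum_j u i 0 * u j 0 * S i j.
  rewrite mxE exchange_big /=; apply: eq_bigr => j _; rewrite mxE mulr_suml.
  by apply: eq_bigr => i _; rewrite mxE; ring.
have -> : \sum_i \sum_j u i 0 * u j 0 * (S i j - mu i 0 * mu j 0) =
  \sum_i \sum_j u i 0 * u j 0 * S i j - (\sum_i u i 0 * mu i 0) ^+ 2.
  rewrite expr2 big_distrlr -sumrB /=; apply: eq_bigr => i _.
  by rewrite -sumrB; apply: eq_bigr => j _; ring.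
rewrite -uSu !mul_scalar_mx !mul_mx_scalar -!scalemxAl.
rewrite [in LHS]mxE [X in X + _ = _]mxE [X in _ + X = _]mxE.
rewrite [X in X + _ + _ = _]mxE [X in _ + X + _ = _]mxE [X in _ + (X + _) = _]mxE muu umu.
by rewrite mxE mulr1n; ring.
Qed.

Lemma sdp_feasibleP mu sigma S : sdp_feasible mu sigma S <->
  [/\ forall i j, S i j = S j i,
      forall i, S i i = mu i 0 ^+ 2 + sigma i 0 ^+ 2,
      forall i j, S i j <= mu j 0 &
      covariance_psd mu S].
Proof.
have diagE i : diag (mu *m mu^T + sigma *m sigma^T) i 0 = mu i 0 ^+ 2 + sigma i 0 ^+ 2.
  by rewrite !mxE !big_ord1 !mxE !expr2.
have boundE i j : ((const_mx 1 : 'cV[R]_n) *m mu^T) i j = mu j 0.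
  by rewrite mxE big_ord1 !mxE mul1r.
split=> [[symS dS bS [_ psdS]]|[symS dS bS psdS]].
  split.
  - by move=> i j; rewrite -{1}symS mxE.
  - by move=> i; rewrite -diagE -dS mxE.
  - by move=> i j; rewrite -(boundE i).
  (* This first coordinate cancels the square in [block_quadratic]. *)
  - move=> u; have := psdS (col_mx (- \sum_i u i * mu i 0)%:M (\col_i u i)).
    have uE i : (\col_i u i) i 0 = u i by rewrite mxE.
    have sE : \sum_i (\col_k u k) i 0 * mu i 0 = \sum_i u i * mu i 0.
      by apply: eq_bigr => i _; rewrite uE.
    rewrite block_quadratic sE addNr expr0n add0r => /le_trans; apply; apply: ler_sum => i _.
    by apply: ler_sum => j _; rewrite !uE.
split.
- by apply/matrixP => i j; rewrite mxE.
- by apply/colP => i; rewrite diagE mxE.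
- by move=> i j; rewrite boundE.
- split.
    by rewrite /symmetric_mx tr_block_mx tr_scalar_mx trmxK; congr block_mx;
      apply/matrixP => i j; rewrite mxE.
  move=> x; rewrite -(vsubmxK x) (mx11_scalar (usubmx x)) block_quadratic.
  by rewrite addr_ge0 ?sqr_ge0.
Qed.

Lemma mxinnerE A S : mxinner A S = \sum_i \sum_j A i j * S i j.
Proof.
rewrite /mxinner /mxtrace exchange_big; apply: eq_bigr => i _.
by rewrite mxE; apply: eq_bigr => j _; rewrite mxE.
Qed.

Definition second_moments (T : finType) (w : T -> R) (x : T -> 'I_n -> R) : 'M[R]_n :=
  \matrix_(i, j) moment w x (Some (inr (i, j))).

Definition law_feasible mu sigma (T : finType) (w : T -> R) (x : T -> 'I_n -> R) :=
  [/\ cube_law w x, forall i, moment w x (Some (inl i)) = mu i 0 &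
      forall i, moment w x (Some (inr (i, i))) = mu i 0 ^+ 2 + sigma i 0 ^+ 2].

(** On the cube x_i x_j <= x_j, whence the entrywise bound; the covariance form at u is the variance
    of the sum of the u_i x_i. *)
Lemma law_feasible_sdp mu sigma (T : finType) (w : T -> R) x :
  law_feasible mu sigma w x -> sdp_feasible mu sigma (second_moments w x).
Proof.
move=> [[w0 w1 x01] mE vE]; apply/sdp_feasibleP; split.
- move=> i j; rewrite !mxE; apply: eq_bigr => t _ /=; ring.
- by move=> i; rewrite mxE.
- move=> i j; rewrite mxE -mE; apply: ler_sum => t _ /=; apply: ler_wpM2l => //.
  have /andP[_ xi1] := x01 t i; have /andP[xj0 _] := x01 t j.
  by rewrite ler_piMl.
- move=> u; pose y t := \sum_i u i * (x t i - mu i 0).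
  have -> : \sum_i \sum_j u i * u j * (second_moments w x i j - mu i 0 * mu j 0) =
      \sum_t w t * (y t) ^+ 2.
    have cov i j : second_moments w x i j - mu i 0 * mu j 0 =
        \sum_t w t * ((x t i - mu i 0) * (x t j - mu j 0)).
      transitivity (moment w x (Some (inr (i, j))) - mu i 0 * moment w x (Some (inl j))
        - mu j 0 * moment w x (Some (inl i)) + mu i 0 * mu j 0 * \sum_t w t).
        by rewrite mxE !mE w1; ring.
      rewrite /moment !mulr_sumr -!sumrB -big_split; apply: eq_bigr => t _ /=; ring.
    under eq_bigr do under eq_bigr do rewrite cov mulr_sumr.
    under eq_bigr do rewrite exchange_big /=.
    rewrite exchange_big; apply: eq_bigr => t _ /=.
    rewrite expr2 big_distrlr mulr_sumr; apply: eq_bigr => i _.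
    by rewrite mulr_sumr; apply: eq_bigr => j _ /=; ring.
  by apply: sumr_ge0 => t _; rewrite mulr_ge0 ?sqr_ge0.
Qed.

Lemma sdp_max A mu sigma : (forall i, 0 <= mu i 0 <= 1) ->
  sdp_feasible mu sigma !=set0 ->
  exists2 S, sdp_feasible mu sigma S &
    forall S', sdp_feasible mu sigma S' -> mxinner A S' <= mxinner A S.
Proof.
move=> mu01 [S0 S0f].
pose V := prod_topology (fun _ : 'I_n * 'I_n => R).
pose mx (v : V) : 'M[R]_n := \matrix_(i, j) v (i, j).
pose K : set V := [set v | sdp_feasible mu sigma (mx v)].
have ev i j : continuous (fun v : V => v (i, j)) by exact: eval_continuous.
have cst (r : R) : continuous (fun _ : V => r) by exact: continuous_constf.
have qE v (u : 'I_n -> R) : \sum_i \sum_j u i * u j * (mx v i j - mu i 0 * mu j 0) =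
    \sum_i \sum_j u i * u j * (v (i, j) - mu i 0 * mu j 0).
  by apply: eq_bigr => i _; apply: eq_bigr => j _; rewrite mxE.
have KE : K = [set v : V | forall i j, v (i, j) = v (j, i)] `&`
    [set v : V | forall i, v (i, i) = mu i 0 ^+ 2 + sigma i 0 ^+ 2] `&`
    [set v : V | forall i j, v (i, j) <= mu j 0] `&`
    [set v : V | forall u : 'I_n -> R, 0 <= \sum_i \sum_j u i * u j * (v (i, j) - mu i 0 * mu j 0)].
  apply/seteqP; split=> v; rewrite /K /= sdp_feasibleP.
    move=> [h1 h2 h3 h4]; split; [split; [split|]|].
    - by move=> i j; have := h1 i j; rewrite !mxE.
    - by move=> i; have := h2 i; rewrite !mxE.
    - by move=> i j; have := h3 i j; rewrite !mxE.
    - by move=> u; rewrite -qE; exact: h4.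
  move=> [[[h1 h2] h3] h4]; split.
  - by move=> i j; rewrite !mxE.
  - by move=> i; rewrite !mxE.
  - by move=> i j; rewrite !mxE.
  - by move=> u; rewrite qE; exact: h4.
have clK : closed K.
  rewrite KE; do 3?apply: closedI.
  - by do 2!apply: closed_forall => ?; exact: closed_eq_fun.
  - by apply: closed_forall => ?; exact: closed_eq_fun.
  - by do 2!apply: closed_forall => ?; exact: closed_le_fun.
  - apply: closed_forall => u; apply: closed_le_fun => //.
    do 2!apply: continuous_sumf => ?; apply: continuous_mulf => //.
    exact: continuous_subf.
have boxK v : K v -> forall ij, -1 <= v ij <= 1.
  rewrite KE => -[[[h1 h2] h3] h4] [i j].
  have [<-|ij] := eqVneq i j.
    rewrite h2 (le_trans (lerN10 _)) ?addr_ge0 ?sqr_ge0//=.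
    by rewrite -h2 (le_trans (h3 i i))//; have /andP[] := mu01 i.
  rewrite (le_trans (h3 i j)) ?andbT; last by have /andP[] := mu01 j.
  (* Testing the form at e_i + e_j bounds off-diagonal entries below: 2 S_ij >= (mu_i + mu_j)^2 -
     S_ii - S_jj >= -2. *)
  pose u k : R := (k == i)%:R + (k == j)%:R.
  have sumu (F : 'I_n -> R) : \sum_k u k * F k = F i + F j.
    rewrite (bigD1 i)//= (bigD1 j) 1?eq_sym//= big1 ?addr0.
      by rewrite /u !eqxx (negbTE ij) eq_sym (negbTE ij) addr0 add0r !mul1r.
    by move=> k /andP[/negbTE ki /negbTE kj]; rewrite /u ki kj addr0 mul0r.
  pose c k l := v (k, l) - mu k 0 * mu l 0.
  have uE : \sum_k \sum_l u k * u l * c k l = (c i i + c i j) + (c j i + c j j).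
    rewrite -(sumu (c i)) -(sumu (c j)) -(sumu (fun k => \sum_l u l * c k l)).
    apply: eq_bigr => k _; rewrite mulr_sumr; apply: eq_bigr => l _.
    by rewrite mulrA.
  have := h4 u; rewrite uE /c (h1 j i).
  have /andP[i0 i1] := mu01 i; have /andP[j0 j1] := mu01 j.
  have := h3 i i; have := h3 j j; have := mulr_ge0 i0 j0.
  have := sqr_ge0 (mu i 0); have := sqr_ge0 (mu j 0); rewrite !expr2; lra.
pose f (v : V) := \sum_i \sum_j A i j * v (i, j).
have fE v : mxinner A (mx v) = f v.
  by rewrite mxinnerE; apply: eq_bigr => i _; apply: eq_bigr => j _; rewrite mxE.
have cf : continuous f.
  by do 2!apply: continuous_sumf => ?; exact: continuous_mulf.
have mxK (S : 'M[R]_n) : mx (fun ij => S ij.1 ij.2) = S.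
  by apply/matrixP => i j; rewrite mxE.
have K0 : K !=set0 by exists (fun ij => S0 ij.1 ij.2); rewrite /K /= mxK.
have [v Kv vmax] := box_argmax K0 clK boxK cf.
exists (mx v) => // S' S'f; rewrite fE -(mxK S') fE.
by apply: vmax; rewrite /K /= mxK.
Qed.

Definition law_objective A (T : finType) (w : T -> R) (x : T -> 'I_n -> R) :=
  mxinner A (second_moments w x).

Lemma law_max A mu sigma :
  (exists v : law_space, law_feasible mu sigma (law_weight v) (law_atom v)) ->
  exists2 v : law_space, law_feasible mu sigma (law_weight v) (law_atom v) &
    forall u : law_space, law_feasible mu sigma (law_weight u) (law_atom u) ->
      law_objective A (law_weight u) (law_atom u) <=
      law_objective A (law_weight v) (law_atom v).
Proof.
move=> K0; pose K := [set v : law_space |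
  law_feasible mu sigma (law_weight v) (law_atom v)].
have cst (r : R) : continuous (fun _ : @law_space R n => r) by exact: continuous_constf.
have clK : closed K.
  rewrite (_ : K = laws `&`
    [set v | forall i, moment (law_weight v) (law_atom v) (Some (inl i)) = mu i 0] `&`
    [set v | forall i, moment (law_weight v) (law_atom v) (Some (inr (i, i))) =
      mu i 0 ^+ 2 + sigma i 0 ^+ 2]); last first.
    by apply/seteqP; split=> v /=; [case|move=> [[]]].
  apply: closedI; first apply: closedI; first exact: laws_closed.
    by apply: closed_forall => i; apply: closed_eq_fun => //; exact: moment_continuous.
  by apply: closed_forall => i; apply: closed_eq_fun => //; exact: moment_continuous.
have cf : continuous (fun v : law_space => law_objective A (law_weight v) (law_atom v)).
  rewrite (_ : (fun v => _) = fun v : law_space => \sum_i \sum_j A i j *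
      moment (law_weight v) (law_atom v) (Some (inr (i, j)))).
    do 2!apply: continuous_sumf => ?; apply: continuous_mulf => //.
    exact: moment_continuous.
  apply/funext => v; rewrite /law_objective mxinnerE.
  by apply: eq_bigr => i _; apply: eq_bigr => j _; rewrite mxE.
have [|v Kv vmax] := box_argmax K0 clK _ cf.
  by move=> v [lv _ _]; exact: laws_box.
by exists v.
Qed.

(** A marginal of a product law: the sum over [f] factors, and every factor other than the [j]-th is
    1. *)
Lemma product_mean (W : 'I_n -> bool -> R) (j : 'I_n) (g : bool -> R) :
  (forall i, \sum_k W i k = 1) ->
  \sum_(f : {ffun 'I_n -> bool}) (\prod_i W i (f i)) * g (f j) = \sum_k W j k * g k.
Proof.
move=> W1; pose F i k := W i k * (if i == j then g k else 1).
transitivity (\sum_(f : {ffun 'I_n -> bool}) \prod_i F i (f i)).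
  apply: eq_bigr => f _; rewrite /F big_split /=; congr (_ * _).
  by rewrite (bigD1 j)//= eqxx big1 ?mulr1// => i /negbTE ->.
rewrite -(bigA_distr_bigA F) (bigD1 j)//= [X in _ * X]big1 ?mulr1.
  by apply: eq_bigr => k _; rewrite /F eqxx.
by move=> i /negbTE ij; rewrite -(W1 i); apply: eq_bigr => k _; rewrite /F ij mulr1.
Qed.

(** Independent coordinates, each with two values supplied by [two_point] for total mass 1. *)
Lemma law_feasible_exists mu sigma : (forall i, 0 <= mu i 0 <= 1) ->
  (forall i, sigma i 0 ^+ 2 <= mu i 0 * (1 - mu i 0)) ->
  exists (w : {ffun 'I_n -> bool} -> R) x, law_feasible mu sigma w x.
Proof.
move=> mu01 sigma_le.
have /choice[vy vyP] i : exists vy : R * R, [/\ 0 <= vy.1 <= 1, 0 <= vy.2 <= 1,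
    vy.1 * vy.2 = mu i 0 & vy.1 * vy.2 ^+ 2 = mu i 0 ^+ 2 + sigma i 0 ^+ 2].
  have [|||v [y vyE]] := @two_point R 1 (mu i 0) (mu i 0 ^+ 2 + sigma i 0 ^+ 2).
  - exact: ler01.
  - by rewrite mul1r lerDl sqr_ge0.
  - by rewrite addr_ge0 ?sqr_ge0//=; have := sigma_le i; rewrite expr2; lra.
  - by exists (v, y).
pose W i (k : bool) := if k then (vy i).1 else 1 - (vy i).1.
have W1 i : \sum_k W i k = 1 by rewrite big_bool /= subrKC.
have W0 i k : 0 <= W i k.
  by have [/andP[v0 v1] _ _ _] := vyP i; case: k => //=; rewrite subr_ge0.
exists (fun f : {ffun 'I_n -> bool} => \prod_i W i (f i)),
  (fun (f : {ffun 'I_n -> bool}) i => if f i then (vy i).2 else 0).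
split; first split.
- by move=> f; apply: prodr_ge0.
- by rewrite -(bigA_distr_bigA W) big1.
- by move=> f i; have [_ y01 _ _] := vyP i; case: (f i); rewrite ?lexx ?ler01.
- move=> i; have [_ _ <- _] := vyP i.
  rewrite /moment (product_mean i (fun k : bool => if k then (vy i).2 else 0) W1).
  by rewrite big_bool /= mulr0 addr0.
- move=> i; have [_ _ _ <-] := vyP i.
  pose y (k : bool) := if k then (vy i).2 else 0.
  rewrite /moment /= (product_mean i (fun k => y k * y k) W1).
  by rewrite big_bool /= !mulr0 addr0 expr2.
Qed.

End Relaxation.

(** * From at most three variables to exactly three *)

Section Padding.
Context {R : realType} {n : nat}.
Implicit Types (f g : 'I_n -> R).

(** Extension by 0: an absent variable becomes the constant 0, with zero mean, deviation and
    covariances. *)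
Definition pad f (k : nat) : R := oapp f 0 (insub k).

Lemma padE f (i : 'I_n) : pad f i = f i.
Proof. by rewrite /pad valK. Qed.

Lemma padP (Q : R -> Prop) f k : Q 0 -> (forall i, Q (f i)) -> Q (pad f k).
Proof. by move=> Q0 Qf; rewrite /pad; case: insub => //= i; exact: Qf. Qed.

Lemma pad_mul (h : nat -> R) f k : pad (fun i => h i * f i) k = h k * pad f k.
Proof. by rewrite /pad; case: insubP => [i _ <-|_] //=; rewrite mulr0. Qed.

Lemma pad_lin (a b d : R) f1 f2 f3 k :
  pad (fun i => a * f1 i + b * f2 i + d * f3 i) k =
  a * pad f1 k + b * pad f2 k + d * pad f3 k.
Proof. by rewrite /pad; case: insub => //=; rewrite !mulr0 !addr0. Qed.

Lemma sum_pad3 f : (n <= 3)%N -> \sum_i f i = pad f 0 + pad f 1 + pad f 2.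
Proof.
move=> n3; rewrite (eq_bigr (fun i : 'I_n => pad f i)) => [|i _]; last by rewrite padE.
rewrite (big_ord_widen 3 (pad f) n3) big_mkcond /= !big_ord_recl big_ord0 addr0 /=.
have E k : (if (k < n)%N then pad f k else 0) = pad f k.
  by rewrite /pad; case: insubP => [i -> //|/negbTE ->].
by rewrite !E addrA.
Qed.

(** The padded covariances of S satisfy the hypotheses of [dominatedP]; restricting the
    three-variable law it provides to the first [n] coordinates gives the law sought. *)
Lemma sdp_dominated (mu sigma : 'cV[R]_n) (S : 'M[R]_n) : (n <= 3)%N ->
  (forall i, 0 <= mu i 0 <= 1) -> (forall i, 0 <= sigma i 0) ->
  (forall i, sigma i 0 ^+ 2 <= mu i 0 * (1 - mu i 0)) ->
  sdp_feasible mu sigma S ->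
  exists (T : finType) (w : T -> R) x, law_feasible mu sigma w x /\
    forall i j, i != j -> S i j <= second_moments w x i j.
Proof.
move=> n3 mu01 sigma0 sigma2 /sdp_feasibleP[symS dS bS psdS].
pose m := pad (fun i => mu i 0); pose s := pad (fun i => sigma i 0).
pose C i j := S i j - mu i 0 * mu j 0.
pose c k l := pad (fun i => pad (C i) l) k.
have m01 k : 0 <= m k <= 1.
  by apply: (@padP (fun z => 0 <= z <= 1) (fun i => mu i 0)); rewrite ?lexx ?ler01.
have s0 k : 0 <= s k by apply: (@padP (fun z => 0 <= z) (fun i => sigma i 0)).
have s2 k : s k ^+ 2 <= m k * (1 - m k).
  by rewrite /s /m /pad; case: insub => //=; rewrite expr0n mul0r.
have bound k l : c k l <= cov_bound (m k) (m l).
  have cb0 : 0 <= cov_bound (m k) (m l).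
    have /andP[k0 k1] := m01 k; have /andP[l0 l1] := m01 l.
    by rewrite le_min !mulr_ge0// subr_ge0.
  move: cb0; rewrite /c /m /pad; case: (insub k) => //= i; case: (insub l) => //= j _.
  rewrite le_min /C; have := bS i j; have := bS j i; rewrite (symS j i) => h1 h2.
  by apply/andP; split; lra.
have cC k l : c k l = c l k.
  rewrite /c /pad; case: (insub k); case: (insub l) => //= i j.
  by rewrite /C symS (mulrC (mu i 0)).
have cD k : c k k = s k ^+ 2.
  rewrite /c /s /pad; case: (insub k) => /= [i|]; last by rewrite expr0n.
  by rewrite /C dS; ring.
have psd : cov_psd (s 0%N ^+ 2) (s 1%N ^+ 2) (s 2%N ^+ 2)
    (c 0 1)%N (c 0 2)%N (c 1 2)%N.
  (* The padded form at (x, y, z) is the original form at the first [n] of these numbers. *)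
  move=> x y z; pose h := nth 0 [:: x; y; z].
  have := psdS (fun i => h i).
  have inner (i : 'I_n) : \sum_(j < n) h i * h j * C i j =
      h i * (h 0%N * pad (C i) 0 + h 1%N * pad (C i) 1 + h 2%N * pad (C i) 2).
    transitivity (\sum_(j < n) h i * (h j * C i j)).
      by apply: eq_bigr => j _; rewrite mulrA.
    by rewrite -mulr_sumr sum_pad3// !pad_mul.
  rewrite (eq_bigr _ (fun i _ => inner i)) sum_pad3// !pad_mul.
  rewrite !pad_lin -!/(c _ _) !cD (cC 1%N 0%N) (cC 2%N 0%N) (cC 2%N 1%N) /h /= => /le_trans; apply.
  by rewrite le_eqVlt; apply/orP; left; apply/eqP; ring.
have [a [b [d [ha hb hd [T [w [x1 [x2 [x3 [w0 w1 x01 [e1 e2 e3] [[v1 v2 v3] [c1 c2 c3]]]]]]]]]]]] :=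
  dominatedP (m01 0%N) (m01 1%N) (m01 2%N) (s0 0%N) (s0 1%N) (s0 2%N) (s2 0%N) (s2 1%N) (s2 2%N)
    psd (bound 0 1)%N (bound 0 2)%N (bound 1 2)%N.
pose X t (k : nat) := nth 0 [:: x1 t; x2 t; x3 t] k.
have i3 (i : 'I_n) : (i < 3)%N by exact: leq_trans n3.
have mean k : (k < 3)%N -> \sum_t w t * X t k = m k.
  by case: k => [|[|[|]]].
have second k : (k < 3)%N -> \sum_t w t * (X t k * X t k) = m k ^+ 2 + s k ^+ 2.
  by case: k => [|[|[|]]].
have cross k l : (k < 3)%N -> (l < 3)%N -> k != l ->
    m k * m l + c k l <= \sum_t w t * (X t k * X t l).
  have wlogC u v (F G : R) : c u v <= F -> G = m u * m v + F ->
      m u * m v + c u v <= G /\ m v * m u + c v u <= G.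
    by move=> cF ->; rewrite (mulrC (m v)) (cC v u) lerD2l.
  have [h01 h10] := wlogC _ _ _ _ ha c1; have [h02 h20] := wlogC _ _ _ _ hb c2.
  have [h12 h21] := wlogC _ _ _ _ hd c3.
  have flip (y y' : T -> R) z : z <= \sum_t w t * (y t * y' t) ->
      z <= \sum_t w t * (y' t * y t).
    by move=> /le_trans; apply; apply: ler_sum => t _; rewrite (mulrC (y t)).
  case: k l => [|[|[|//]]] [|[|[|//]]] //= _ _ _.
  - exact: flip.
  - exact: flip.
  - exact: flip.
exists T, w, (fun t i => X t i); split; first split.
- split=> // t i; have [h1 h2 h3] := x01 t.
  by have := i3 i; rewrite /X; case: (nat_of_ord i) => [|[|[|]]].
- by move=> i; have := mean _ (i3 i); rewrite /m padE.
- by move=> i; have := second _ (i3 i); rewrite /m /s !padE.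
- move=> i j ij; rewrite mxE.
  have := cross i j (i3 i) (i3 j) ij.
  by rewrite /m /c !padE /C addrC subrK.
Qed.

End Padding.

(** * Exchanging probabilities and finite laws *)

Section MomentProblem.
Context {R : realType} {n : nat}.
Implicit Types (A : 'M[R]_n) (mu sigma : 'cV[R]_n) (P : probability (n.-tuple R) R).

Lemma moment_feasibleP mu sigma P : moment_feasible mu sigma P <->
  [/\ P (@unit_cube R n) = 1%E,
      forall i, cube_moment P (Some (inl i)) = mu i 0 &
      forall i, cube_moment P (Some (inr (i, i))) = mu i 0 ^+ 2 + sigma i 0 ^+ 2].
Proof.
have firstE i : (fun x : n.-tuple R => colv x i 0) =
    (fun x => monomial (tnth x) (Some (inl i))).
  by apply/funext => x; rewrite mxE.
have secondE i : (fun x : n.-tuple R => diag (colv x *m (colv x)^T) i 0) =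
    (fun x => monomial (tnth x) (Some (inr (i, i)))).
  by apply/funext => x; rewrite !mxE big_ord1 !mxE.
have diagE i : diag (mu *m mu^T + sigma *m sigma^T) i 0 = mu i 0 ^+ 2 + sigma i 0 ^+ 2.
  by rewrite !mxE !big_ord1 !mxE !expr2.
split=> -[Pc mE vE]; split=> // i.
- by have := mE i; rewrite firstE expectation_monomial// => -[].
- by have := vE i; rewrite secondE expectation_monomial// diagE => -[].
- by rewrite firstE expectation_monomial// mE.
- by rewrite secondE expectation_monomial// diagE vE.
Qed.

Lemma moment_objectiveE A P : P (@unit_cube R n) = 1%E ->
  moment_objective A P =
  (mxinner A (\matrix_(i, j) cube_moment P (Some (inr (i, j)))))%:E.
Proof.
move=> Pc; rewrite /moment_objective.
have -> : (fun x : n.-tuple R => ((colv x)^T *m A *m colv x) 0 0) =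
    (fun x => \sum_(k : 'I_n * 'I_n) A k.1 k.2 * monomial (tnth x) (Some (inr k))).
  apply/funext => x; rewrite -(pair_bigA _ (fun i j => A i j * (tnth x i * tnth x j)))/=.
  rewrite mxE exchange_big /=; apply: eq_bigr => j _; rewrite mxE mulr_suml.
  by apply: eq_bigr => i _; rewrite !mxE; ring.
have [mf intf fE] := cube_moment_sum Pc (index_enum _) (fun k : 'I_n * 'I_n => A k.1 k.2)
  (fun k => Some (inr k)).
rewrite (expectation_cube Pc mf intf) fE mxinnerE.
rewrite -(pair_bigA _ (fun i j => A i j * cube_moment P (Some (inr (i, j)))))/=.
by congr EFin; apply: eq_bigr => i _; apply: eq_bigr => j _; rewrite mxE.
Qed.

Lemma law_of_probability mu sigma A P : moment_feasible mu sigma P ->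
  exists2 v : law_space, law_feasible mu sigma (law_weight v) (law_atom v) &
    moment_objective A P = (law_objective A (law_weight v) (law_atom v))%:E.
Proof.
move=> /moment_feasibleP[Pc mE vE]; have [v lv vP] := cube_moment_laws Pc.
exists v; first by split=> // i; rewrite vP.
rewrite moment_objectiveE// /law_objective !mxinnerE; congr EFin.
by apply: eq_bigr => i _; apply: eq_bigr => j _; rewrite !mxE vP.
Qed.

Lemma probability_of_law mu sigma A (T : finType) (w : T -> R) x :
  law_feasible mu sigma w x ->
  exists2 P, moment_feasible mu sigma P & moment_objective A P = (law_objective A w x)%:E.
Proof.
move=> [lwx mE vE]; have [P [Pc PE]] := probability_of_atoms lwx.
exists P; first by apply/moment_feasibleP; split=> // i; rewrite PE.
rewrite moment_objectiveE// /law_objective !mxinnerE; congr EFin.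
by apply: eq_bigr => i _; apply: eq_bigr => j _; rewrite !mxE PE.
Qed.

End MomentProblem.

(** * Attainment and comparison of the two optimal values *)

Theorem proposition9 (R : realType) (n : nat) (A : 'M[R]_n)
    (mu sigma : 'cV[R]_n)
    (symA : symmetric_mx A)
    (* [Num.sqrt] is 0 on negative numbers, so [0 <= mu i 0 <= 1] does not
       follow from the bound on sigma and has to be stated. *)
    (mu01 : forall i, 0 <= mu i 0 <= 1)
    (sigma_bound :
      forall i, 0 <= sigma i 0 <= Num.sqrt (mu i 0 * (1 - mu i 0)))
    (submodNA : submodular (- A)) :
  exists v_star v_SDP : R,
    [/\ is_max [set moment_objective A P | P in moment_feasible mu sigma]
          (v_star%:E),
        is_max [set mxinner A Sigma | Sigma in sdp_feasible mu sigma] v_SDP,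
        v_star <= v_SDP &
        (n <= 3)%N -> v_star = v_SDP].
Proof.
have sigma0 i : 0 <= sigma i 0 by have /andP[] := sigma_bound i.
have sigma2 i : sigma i 0 ^+ 2 <= mu i 0 * (1 - mu i 0).
  have /andP[s0 sb] := sigma_bound i; have /andP[m0 m1] := mu01 i.
  rewrite -[leRHS]sqr_sqrtr; last by rewrite mulr_ge0// subr_ge0.
  by rewrite ler_pXn2r// nnegrE// sqrtr_ge0.
have A0 i j : i != j -> 0 <= A i j.
  by move=> ij; have := submodNA.2 i j ij; rewrite mxE oppr_le0.
have [T0 [w0 [x0 f0]]] : exists (T : finType) (w : T -> R) x, law_feasible mu sigma w x.
  by have [w [x f]] := law_feasible_exists mu01 sigma2; exists {ffun 'I_n -> bool}, w, x.
(* A law on any finite type is read as a probability and then reduced to [natoms] atoms, so that it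
   can be compared with the maximizer in [law_space]. *)
have compress (T : finType) (w : T -> R) x : law_feasible mu sigma w x ->
    exists2 v : law_space, law_feasible mu sigma (law_weight v) (law_atom v) &
      law_objective A w x = law_objective A (law_weight v) (law_atom v).
  move=> /(probability_of_law A)[P Pf PE].
  have [v vf vE] := law_of_probability A Pf.
  by exists v => //; move: PE; rewrite vE => -[].
have [v0 v0f _] := compress _ _ _ f0.
have [v vf vmax] : exists2 v : law_space, law_feasible mu sigma (law_weight v) (law_atom v) &
    forall u : law_space, law_feasible mu sigma (law_weight u) (law_atom u) ->
      law_objective A (law_weight u) (law_atom u) <=
      law_objective A (law_weight v) (law_atom v).
  by apply: law_max; exists v0.
have [S Sf Smax] : exists2 S, sdp_feasible mu sigma S &
    forall S', sdp_feasible mu sigma S' -> mxinner A S' <= mxinner A S.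
  by apply: sdp_max => //; exists (second_moments w0 x0); exact: law_feasible_sdp.
exists (law_objective A (law_weight v) (law_atom v)), (mxinner A S).
have vS : law_objective A (law_weight v) (law_atom v) <= mxinner A S.
  exact/Smax/law_feasible_sdp.
split=> //.
- split; first by have [P Pf PE] := probability_of_law A vf; exists P.
  move=> _ [P Pf <-]; have [u uf ->] := law_of_probability A Pf.
  by rewrite lee_fin vmax.
- split; first by exists S.
  by move=> _ [S' S'f <-]; exact: Smax.
- move=> n3; apply/le_anti; rewrite vS /=.
  (* A feasible law dominates the optimal S off the diagonal, where A is nonnegative, and agrees
     with it on the diagonal, where A may have any sign. *)
  have [T [w [x [wf Sle]]]] := sdp_dominated n3 mu01 sigma0 sigma2 Sf.
  have [u uf uE] := compress _ _ _ wf.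
  apply: le_trans (vmax u uf); rewrite -uE /law_objective !mxinnerE.
  apply: ler_sum => i _; apply: ler_sum => j _.
  have [<-|ij] := eqVneq i j; last by rewrite ler_wpM2l ?A0// Sle.
  have /sdp_feasibleP[_ dS _ _] := Sf.
  by have [_ _ vE] := wf; rewrite mxE vE dS.
Qed.
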